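(* For $m=2$, $p_2^{\mathrm{convex}}\ge 2.0186$; more precisely $p_2^{\mathrm{convex}}\ge 2+2/\sqrt{11559}$.
   Context: In $\mathbb{R}^2$: for a non-empty open $\Omega$ with $|\Omega|<\infty$, $\lambda_1(\Omega)=\inf_{\varphi\in H_0^1(\Omega)\setminus\{0\}}\int_\Omega|D\varphi|^2/\int_\Omega\varphi^2$, $v_\Omega$ is the unique solution of $-\Delta v=1$, $v\in H_0^1(\Omega)$, $F_p(\Omega)=\|v_\Omega\|_{L^p(\Omega)}\lambda_1(\Omega)/|\Omega|^{1/p}$, $\mathfrak{F}^{\mathrm{convex}}_p=\sup\{F_p(\Omega):\Omega\text{ open, convex in }\mathbb{R}^2,\ 0<|\Omega|<\infty\}$, and $p_2^{\mathrm{convex}}=\inf\{p\ge1:\mathfrak{F}^{\mathrm{convex}}_p>1\}$. *)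

(* Defs.v *)
From HB Require Import structures.
From mathcomp Require Import all_boot all_order all_algebra.
From mathcomp Require Import all_classical all_reals all_analysis.
Import Order.TTheory GRing.Theory Num.Theory.
Import numFieldNormedType.Exports.

Set Implicit Arguments.
Unset Strict Implicit.
Unset Printing Implicit Defensive.

Local Open Scope classical_set_scope.
Local Open Scope ring_scope.

Section Defs.
Variable R : realType.

Definition leb2 : {measure set (measurableTypeR R * measurableTypeR R) -> \bar R} :=
  (lebesgue_measure \x lebesgue_measure)%E.

Definition dir (b : bool) : R * R := if b then (0, 1) else (1, 0).

Definition partial (b : bool) (f : R * R -> R) : R * R -> R :=
  fun x => 'D_(dir b) f x.

Definition iter_partial (l : seq bool) (f : R * R -> R) : R * R -> R :=
  foldr partial f l.

Definition smooth (f : R * R -> R) : Prop :=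
  forall (l : seq bool) (x : R * R), differentiable (iter_partial l f) x.

Definition test_fun (Om : set (R * R)) (f : R * R -> R) : Prop :=
  smooth f /\ exists K : set (R * R), [/\ compact K, K `<=` Om &
                                         forall x, ~ K x -> f x = 0].

Definition sqL2 (f : R * R -> R) : \bar R := (\int[leb2]_x ((f x) ^+ 2)%:E)%E.

(* (u, (g1, g2)) is an element of H_0^1(Omega) (closure of C_c^infinity(Omega)
   in the H^1 norm), g = (g1, g2) being its weak gradient Du. *)
Definition H01 (Om : set (R * R)) (u g1 g2 : R * R -> R) : Prop :=
  [/\ measurable_fun setT u, measurable_fun setT g1, measurable_fun setT g2 &
    exists phi : nat -> R * R -> R,
      (forall n, test_fun Om (phi n)) /\
      ((fun n => sqL2 (fun x => (phi n x - u x)%R)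
                 + sqL2 (fun x => (partial false (phi n) x - g1 x)%R)
                 + sqL2 (fun x => (partial true (phi n) x - g2 x)%R))%E
         @ \oo --> 0%E)].

Definition intOm (Om : set (R * R)) (f : R * R -> R) : \bar R :=
  (\int[leb2]_(x in Om) (f x)%:E)%E.

Definition lambda1 (Om : set (R * R)) : \bar R :=
  ereal_inf [set q | exists u g1 g2, [/\ H01 Om u g1 g2,
      intOm Om (fun x => u x ^+ 2) != 0%E &
      q = (fine (intOm Om (fun x => g1 x ^+ 2 + g2 x ^+ 2))
           / fine (intOm Om (fun x => u x ^+ 2)))%:E]].

(* v (with weak gradient (g1,g2)) is the solution of -Delta v = 1, v in H_0^1(Omega),
   in the weak sense: int Dv.Dphi = int phi for all phi in C_c^infinity(Omega). *)
Definition torsion (Om : set (R * R)) (v g1 g2 : R * R -> R) : Prop :=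
  H01 Om v g1 g2 /\
  forall phi, test_fun Om phi ->
    intOm Om (fun x => g1 x * partial false phi x + g2 x * partial true phi x)
    = intOm Om phi.

Definition convex2 (Om : set (R * R)) : Prop :=
  forall x y, Om x -> Om y -> forall t : R, 0 <= t <= 1 ->
    Om ((1 - t) * x.1 + t * y.1, (1 - t) * x.2 + t * y.2).

Definition Fp (Om : set (R * R)) (p : R) (v : R * R -> R) : \bar R :=
  (Lnorm leb2 p%:E (fun x => (v x * \1_Om x)%:E) * lambda1 Om
   * ((fine (leb2 Om) `^ p^-1)^-1)%:E)%E.

Definition Fconvex (p : R) : \bar R :=
  ereal_sup [set F | exists Om v g1 g2,
    [/\ open Om /\ convex2 Om, (0 < leb2 Om)%E, (leb2 Om < +oo)%E,
        torsion Om v g1 g2 & F = Fp Om p v]].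

Definition p2convex : \bar R :=
  ereal_inf [set q | exists p : R, [/\ 1 <= p, (1 < Fconvex p)%E & q = p%:E]].

End Defs.

(* Main.v *)
Require Import Defs.
From HB Require Import structures.
From mathcomp Require Import all_boot all_order all_algebra.
From mathcomp Require Import all_classical all_reals all_analysis.
From mathcomp Require Import measurable_realfun ring lra.
Import Order.TTheory GRing.Theory Num.Theory.
Import numFieldNormedType.Exports.
Local Open Scope classical_set_scope.
Local Open Scope ring_scope.
Set Implicit Arguments.
Unset Strict Implicit.
Unset Printing Implicit Defensive.

(** Write A for the area of a convex domain, lam for its first eigenvalue, v for
    its torsion function and w = lam v.

    Testing the eigenvalue with a truncation K of v^2 and the torsion equation
    with a truncation G of v^3, chosen so that K'^2 <= 4/3 G', and letting the
    truncation go away gives int w^4 <= 16/9 int w^2.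

    Let L be the supremum of the lengths of the horizontal chords. On every
    chord, w vanishes at the ends, hence cannot be close to 1: comparing with
    the derivative of q (w^2 - 2 w), q = k (x - midpoint), one gets
    int w_x^2 + M (w - 1)^2 >= k A for M = k + k^2 L^2 / 4. On the other hand
    int |Dw|^2 = lam int w and int w^2 <= int w. If the horizontal width is at
    most the vertical one, the midpoints between a nearly longest chord and a
    segment joining nearly extreme points in the vertical direction fill a
    parallelogram whose eigenvalue is at most 130 / L^2, so lam <= 130 / L^2;
    otherwise exchange the coordinates. With k = 260 / L^2 this yields
    int w^2 <= 130/131 A.

    Finally t^p <= (1 - th) t^2 + th t^4 for p = 2 + 2 th, so that
    int w^p <= (1 + 7/9 th) 130/131 A <= A as soon as th <= 1/107, and
    1/107 > 1 / sqrt 11559. *)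

(** The fourth moment comes from the identity |D(v^2)|^2 = 4/3 Dv . D(v^3): the Rayleigh inequality
    and the weak equation give lam int v^4 <= 4/3 int v^3, and Young's inequality turns this into
    the constant 16/9. As v is only an H^1 limit of test functions, its powers are not admissible;
    rational truncations with bounded derivative keep every limit an L^2 limit.

    With int w^2 <= A alone, the fourth moment gives nothing beyond p = 2: a gap uniform over all
    convex domains is required. It has to be scale invariant, hence the pairing of lam <= c / L^2
    with a chord inequality for k = kappa / L^2. Together they give int w <= (kappa^2/4) /
    (kappa^2/4 + kappa - c) A, which is best at kappa = 2 c, with ratio c / (c + 1).

    Comparing the two widths makes the height of the parallelogram dominate, up to constants, both L
    and the horizontal offset, so side, height and shear each cost about 4 / L^2. The
    one-dimensional factor is about 10, the Rayleigh quotient of r (1 - r) on [0, 1]; 10 times 12,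
    with slack for unattained suprema and for smoothing, gives c = 130. *)

Section plane_measurability.
Variable R : realType.
Local Notation plane := (measurableTypeR R * measurableTypeR R)%type.

(** The measurable structure of the plane is the product one, whereas openness refers to the norm
    topology; an open set is the countable union of the rational boxes it contains. *)
Lemma open_measurable_plane (U : set (R * R)) : open U ->
  measurable (U : set plane).
Proof.
move=> oU.
pose box (q : rat * rat * (rat * rat)) : set (R * R) :=
  `]ratr q.1.1, ratr q.1.2[%classic `*` `]ratr q.2.1, ratr q.2.2[%classic.
have -> : U = \bigcup_q (if `[< box q `<=` U >] then box q else set0).
  apply/seteqP; split => [[x y] Uxy|xy [q _]]; last first.
    by case: ifPn => // /asboolP; apply.
  have /nbhs_ballP[e /= e0 eU] : nbhs (x, y) U by apply: open_nbhs_nbhs.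
  have [a] := @rat_in_itvoo R (x - e) x ltac:(lra).
  rewrite in_itv/= => /andP[a1 a2].
  have [b] := @rat_in_itvoo R x (x + e) ltac:(lra).
  rewrite in_itv/= => /andP[b1 b2].
  have [c] := @rat_in_itvoo R (y - e) y ltac:(lra).
  rewrite in_itv/= => /andP[c1 c2].
  have [d] := @rat_in_itvoo R y (y + e) ltac:(lra).
  rewrite in_itv/= => /andP[d1 d2].
  exists (a, b, (c, d)) => //=.
  rewrite ifT; first by split; rewrite /= in_itv/=; apply/andP.
  apply/asboolP => -[s t] /= [] /=; rewrite !in_itv/= => /andP[s1 s2] /andP[t1 t2].
  apply: eU; split; rewrite /ball/= ltr_norml; lra.
apply: countable_bigcupT_measurable; first exact: countableP.
move=> q; case: ifP => // _.
by apply: measurableX; exact: measurable_itv.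
Qed.

Lemma continuous_measurable_plane (f : R * R -> R) : continuous f ->
  measurable_fun (setT : set plane) f.
Proof.
move=> cf; apply: (measurability _ (RGenOpens.measurableE R)) => //.
move=> _ [_ [a [b ->] <-]]; rewrite setTI.
apply: open_measurable_plane.
by apply: open_comp => // x _; exact: cf.
Qed.

End plane_measurability.

(** * Smooth functions on the plane *)

Section smooth_algebra.
Variable R : realType.
Implicit Types (B : set (R * R -> R)) (f g : R * R -> R).

Inductive fun_alg B : (R * R -> R) -> Prop :=
| fun_alg_base g : B g -> fun_alg B g
| fun_alg_cst c : fun_alg B (fun=> c)
| fun_algD f g : fun_alg B f -> fun_alg B g -> fun_alg B (fun x => f x + g x)
| fun_algM f g : fun_alg B f -> fun_alg B g -> fun_alg B (fun x => f x * g x).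

Lemma partialD b f g x : differentiable f x -> differentiable g x ->
  partial b (fun x => f x + g x) x = partial b f x + partial b g x.
Proof. by move=> df dg; apply: deriveD; exact: diff_derivable. Qed.

Lemma partialM b f g x : differentiable f x -> differentiable g x ->
  partial b (fun x => f x * g x) x = f x * partial b g x + g x * partial b f x.
Proof. by move=> df dg; apply: deriveM; exact: diff_derivable. Qed.

Lemma partial_cst b (c : R) x : partial b (fun=> c) x = 0.
Proof. exact: derive_cst. Qed.

Lemma partial_comp b (h : R -> R) dh f x : differentiable f x ->
  is_derive (f x) 1 h dh -> partial b (h \o f) x = dh * partial b f x.
Proof.
move=> df [hd hE].
have dh' : differentiable h (f x) by apply/derivable1_diffP.
rewrite /partial deriveE; last exact: differentiable_comp.
rewrite diff_comp//= deriveE//.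
by rewrite deriv1E// /= derive1E hE mulrC.
Qed.

Lemma differentiable_comp_fun (h : R -> R) dh f x : differentiable f x ->
  is_derive (f x) 1 h dh -> differentiable (h \o f) x.
Proof.
by move=> df [hd hE]; apply: differentiable_comp => //; apply/derivable1_diffP.
Qed.

(** Since [smooth] quantifies over all iterated partials, no explicit formula for them is attempted:
    if the partials of the generators stay in the algebra, the sum and product rules keep all
    partials there, and every member is differentiable. *)
Lemma fun_alg_smooth B :
  (forall g, B g -> (forall x, differentiable g x) /\
                    forall b, fun_alg B (partial b g)) ->
  forall f, fun_alg B f -> smooth f.
Proof.
move=> hB.
have alg_diff f : fun_alg B f -> forall x, differentiable f x.
  elim=> {f} [g /hB[]//|c x|f g _ df _ dg x|f g _ df _ dg x].
  - exact: differentiable_cst.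
  - exact: differentiableD.
  - exact: differentiableM.
have alg_partial f b : fun_alg B f -> fun_alg B (partial b f).
  elim=> {f} [g /hB[]//|c|f g af pf ag pg|f g af pf ag pg].
  - have -> : partial b (fun=> c) = fun=> 0 by apply/funext => x; exact: partial_cst.
    exact: fun_alg_cst.
  - rewrite (_ : partial b _ = fun x => partial b f x + partial b g x).
      exact: fun_algD.
    by apply/funext => x; rewrite partialD//; exact: alg_diff.
  - rewrite (_ : partial b _ =
      fun x => f x * partial b g x + g x * partial b f x).
      by apply: fun_algD; exact: fun_algM.
    by apply/funext => x; rewrite partialM//; exact: alg_diff.
move=> f af l x; apply: alg_diff.
by elim: l => //= b l; exact: alg_partial.
Qed.

Lemma smooth_iter_partial f l : smooth f -> smooth (iter_partial l f).
Proof. by move=> sf l' x; have := sf (l' ++ l) x; rewrite /iter_partial foldr_cat. Qed.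

Lemma smooth_partial b f : smooth f -> smooth (partial b f).
Proof. exact: (@smooth_iter_partial f [:: b]). Qed.

Lemma smooth_differentiable f x : smooth f -> differentiable f x.
Proof. by move=> /(_ [::] x). Qed.

Lemma smooth_continuous f : smooth f -> continuous f.
Proof.
by move=> sf x; apply: differentiable_continuous; exact: smooth_differentiable.
Qed.

End smooth_algebra.

(** * Truncations and flat functions *)

Section real_derivatives.
Variable R : realType.
Implicit Types (f g : R -> R) (x : R).

Lemma is_derive1D f g x df dg : is_derive x 1 f df -> is_derive x 1 g dg ->
  is_derive x 1 (fun t => f t + g t) (df + dg).
Proof. exact: is_deriveD. Qed.

Lemma is_derive1M f g x df dg : is_derive x 1 f df -> is_derive x 1 g dg ->
  is_derive x 1 (fun t => f t * g t) (f x * dg + g x * df).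
Proof. exact: is_deriveM. Qed.

Lemma is_derive1V f x df : f x != 0 -> is_derive x 1 f df ->
  is_derive x 1 (fun t => (f t)^-1) (- (f x) ^- 2 * df).
Proof.
move=> fx0 [fd fE]; split; first exact: derivableV.
by rewrite deriveV// fE.
Qed.

Lemma is_derive1_id x : is_derive x 1 (fun t : R => t) 1.
Proof. exact: is_derive_id. Qed.

Lemma is_derive1_cst (c : R) x : is_derive x 1 (fun=> c) 0.
Proof. exact: is_derive_cst. Qed.

Lemma is_derive1X f n x df : is_derive x 1 f df ->
  is_derive x 1 (fun t => f t ^+ n) (n%:R * f x ^+ n.-1 * df).
Proof.
move=> fd; have := is_deriveX n fd; congr (is_derive _ _ _ _).
by apply/funext => t; rewrite /= fctE.
Qed.

Lemma is_derive1_sq x : is_derive x 1 (fun t : R => t ^+ 2) (2 * x).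
Proof. by apply: is_derive_eq (is_derive1X 2 (is_derive1_id x)) _; ring. Qed.

Variable e : R.
Hypothesis e0 : 0 < e.

Let den_gt0 (t : R) : 0 < 1 + e * t ^+ 2.
Proof. by rewrite ltr_pwDl// mulr_ge0 ?sqr_ge0// ltW. Qed.

(** The damping factor of both truncations. It tends to 1 as e goes to 0, and its derivative is a
    polynomial in t and itself, which makes smoothness of the compositions purely algebraic. *)
Definition cutinv (t : R) : R := (1 + e * t ^+ 2)^-1.

Lemma is_derive_cutinv (t : R) :
  is_derive t 1 cutinv (- (2 * e * t) * cutinv t ^+ 2).
Proof.
have h := den_gt0 t.
have := @is_derive1V (fun t => 1 + e * t ^+ 2) t _ (lt0r_neq0 h) (is_derive1D (is_derive1_cst 1 t)
  (is_derive1M (is_derive1_cst e t) (is_derive1_sq t))).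
by move=> /is_derive_eq; apply; rewrite /cutinv; field; rewrite gt_eqF.
Qed.

Definition cut2 (t : R) : R := t ^+ 2 * cutinv t.
Definition cut3 (t : R) : R := t ^+ 3 * cutinv t.

Lemma is_derive_cut2 (t : R) : is_derive t 1 cut2 (2 * t * cutinv t ^+ 2).
Proof.
have := is_derive1M (is_derive1_sq t) (is_derive_cutinv t).
move=> /is_derive_eq; apply.
by rewrite /cutinv; have := den_gt0 t => h; field; rewrite gt_eqF.
Qed.

Lemma is_derive_cut3 (t : R) :
  is_derive t 1 cut3 ((3 * t ^+ 2 + e * t ^+ 4) * cutinv t ^+ 2).
Proof.
have := is_derive1M (is_derive1X 3 (is_derive1_id t)) (is_derive_cutinv t).
move=> /is_derive_eq; apply.
by rewrite /cutinv; have := den_gt0 t => h; rewrite /=; field; rewrite gt_eqF.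
Qed.

(** Used to keep the gradients of [cut3 e \o phi n] bounded in L^2. With x = e t^2, the upper bound
    reduces to 3 x + x^2 <= 3 (1 + x)^2. *)
Lemma cut3_derive_bound t :
  0 <= (3 * t ^+ 2 + e * t ^+ 4) * cutinv t ^+ 2 <= 3 / e.
Proof.
have h := den_gt0 t; have t2 := sqr_ge0 t.
rewrite /cutinv exprVn (_ : t ^+ 4 = (t ^+ 2) ^+ 2); last by rewrite -exprM.
set s := t ^+ 2 in h t2 *.
apply/andP; split.
  by rewrite divr_ge0// ?sqr_ge0//; have := sqr_ge0 s; nra.
rewrite ler_pdivrMr ?exprn_gt0// mulrAC ler_pdivlMr//.
have es : 0 <= e * s by rewrite mulr_ge0// ltW.
have -> : (3 * s + e * s ^+ 2) * e = 3 * (e * s) + (e * s) ^+ 2 by ring.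
by have := sqr_ge0 (e * s); nra.
Qed.

(** This is K'^2 <= 4/3 G', an equality for K = t^2 and G = t^3. It survives truncation because the
    left side carries [cutinv] to the power 4, the right side only to the power 2, and [cutinv] is
    at most 1. *)
Lemma cut2_derive_sq_le t : (2 * t * cutinv t ^+ 2) ^+ 2 <=
  4 / 3 * ((3 * t ^+ 2 + e * t ^+ 4) * cutinv t ^+ 2).
Proof.
have h := den_gt0 t; have t2 := sqr_ge0 t.
have i0 : 0 < cutinv t by rewrite invr_gt0.
have i1 : cutinv t <= 1 by rewrite invf_le1// lerDl mulr_ge0// ltW.
have i2 : cutinv t ^+ 4 <= cutinv t ^+ 2.
  by rewrite ler_wiXn2l// ltW.
have -> : (2 * t * cutinv t ^+ 2) ^+ 2 = 4 * t ^+ 2 * cutinv t ^+ 4 by ring.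
have : 0 <= e * (t ^+ 4 * cutinv t ^+ 2).
  rewrite (_ : t ^+ 4 = (t ^+ 2) ^+ 2); last by rewrite -exprM.
  by rewrite mulr_ge0 ?(ltW e0)// mulr_ge0 ?sqr_ge0.
have := ler_wpM2l t2 i2; nra.
Qed.

(** Transfers L^2 convergence from [phi n] to [cut2 e \o phi n]. The difference quotient is (s + t)
    / ((1 + x) (1 + y)) with x = e s^2, y = e t^2, and e (s + t)^2 <= 2 x + 2 y <= (1 + x + y)^2. *)
Lemma cut2_lip s t : (cut2 s - cut2 t) ^+ 2 <= e^-1 * (s - t) ^+ 2.
Proof.
have hs := den_gt0 s; have ht := den_gt0 t.
have -> : cut2 s - cut2 t =
    (s - t) * ((s + t) / ((1 + e * s ^+ 2) * (1 + e * t ^+ 2))).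
  by rewrite /cut2 /cutinv; field; rewrite !gt_eqF.
rewrite exprMn mulrC ler_wpM2r ?sqr_ge0//.
rewrite expr_div_n ler_pdivrMr ?exprn_gt0 ?mulr_gt0// mulrC ler_pdivlMr//.
have es : 0 <= e * s ^+ 2 by rewrite mulr_ge0 ?sqr_ge0 ?ltW.
have et : 0 <= e * t ^+ 2 by rewrite mulr_ge0 ?sqr_ge0 ?ltW.
have est := mulr_ge0 es et.
have -> : (s + t) ^+ 2 * e =
    2 * (e * s ^+ 2) + 2 * (e * t ^+ 2) - e * (s - t) ^+ 2 by ring.
have : 0 <= e * (s - t) ^+ 2 by rewrite mulr_ge0 ?sqr_ge0 ?ltW.
set x := e * s ^+ 2 in es est *; set y := e * t ^+ 2 in et est *.
have : 1 + x + y <= (1 + x) * (1 + y) by nra.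
have : (1 + x + y) ^+ 2 <= ((1 + x) * (1 + y)) ^+ 2 by nra.
nra.
Qed.

Lemma cut2_ge0 t : 0 <= cut2 t.
Proof. by rewrite mulr_ge0 ?sqr_ge0// invr_ge0 ltW. Qed.

Lemma cut2_0 : cut2 0 = 0.
Proof. by rewrite /cut2 expr0n mul0r. Qed.

Lemma cut3E t : cut3 t = cut2 t * t.
Proof. by rewrite /cut2 /cut3; ring. Qed.

End real_derivatives.

Section flat_functions.
Variables (R : realType) (a : R).
Hypothesis a0 : 0 < a.

(** The powers p^-k are carried along because the derivatives of exp (- a / p) are combinations of
    members of this family, which is thus closed under differentiation. *)
Definition flat (k : nat) (p : R) : R :=
  if 0 < p then p ^- k * expR (- a / p) else 0.

(** From exp y >= (y / n)^n with n = k + 2: two powers beyond those needed to cancel p^-k remain.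
    Quadratic decay is what makes the derivative at 0 vanish. *)
Lemma flat_bound k p : `|flat k p| <= (k.+2%:R / a) ^+ k.+2 * p ^+ 2.
Proof.
rewrite /flat; case: ifPn => [p0|_]; last first.
  by rewrite normr0 mulr_ge0 ?sqr_ge0// exprn_ge0// divr_ge0// ltW.
rewrite ger0_norm ?mulr_ge0 ?expR_ge0 ?invr_ge0 ?exprn_ge0 ?(ltW p0)//.
have y0 : 0 < a / p / k.+2%:R by rewrite !divr_gt0.
have h : (a / p / k.+2%:R) ^+ k.+2 <= expR (a / p).
  rewrite -[in leRHS](@divfK _ k.+2%:R _ (a / p)) ?pnatr_eq0//.
  rewrite expRM_natr; apply: lerXn2r; rewrite ?nnegrE ?expR_ge0 ?(ltW y0)//.
  by apply: le_trans (expR_ge1Dx _); rewrite lerDr.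
rewrite mulNr expRN ler_pdivrMr ?expR_gt0//.
have -> : p ^- k = (k.+2%:R / a) ^+ k.+2 * p ^+ 2 * (a / p / k.+2%:R) ^+ k.+2.
  rewrite mulrAC -exprMn (_ : k.+2%:R / a * _ = p^-1); last first.
    by field; rewrite !gt_eqF// pnatr_eq0.
  by rewrite -addn2 exprD exprVn -mulrA -exprMn mulVf ?gt_eqF// expr1n mulr1.
by rewrite ler_wpM2l// mulr_ge0 ?sqr_ge0// exprn_ge0// divr_ge0// ltW.
Qed.

End flat_functions.
Section flat_derivative.
Variables (R : realType) (a : R).
Hypothesis a0 : 0 < a.

Lemma is_derive_flat k (p : R) : is_derive p 1 (flat a k)
  (- k%:R * flat a k.+1 p + a * flat a k.+2 p).
Proof.
have [p0|p0|->] := ltgtP p 0.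
- have E j : flat a j p = 0 by rewrite /flat ltNge (ltW p0).
  rewrite !E !mulr0 addr0.
  have := is_derive1_cst 0 p; apply: near_eq_is_derive.
  near=> q; rewrite /flat ifF//; apply/negbTE; rewrite -leNgt ltW//.
  by near: q; exact: lt_nbhsl.
- have E j : flat a j p = p ^- j * expR (- a / p) by rewrite /flat p0.
  rewrite !E.
  have pk0 : p ^+ k != 0 by rewrite gt_eqF ?exprn_gt0.
  have d1 := @is_derive1V R (fun t => t ^+ k) p _ pk0 (is_derive1X k (is_derive1_id p)).
  have d2 := is_derive1M (is_derive1_cst (- a) p)
    (@is_derive1V R (fun t => t) p _ (lt0r_neq0 p0) (is_derive1_id p)).
  have d3 := @is_derive1_comp R expR (fun t => - a * t^-1) p _ _ (is_derive_expR _) d2.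
  have := is_derive1M d1 d3.
  move=> /is_derive_eq D; apply: (near_eq_is_derive _ (D _ _)).
    near=> q; rewrite /flat ifT//; near: q; exact: lt_nbhsr.
  rewrite /=; move: p0; clear; case: k => [|k] /= p0; first by field; rewrite gt_eqF.
  by rewrite !exprS; field; rewrite !gt_eqF ?exprn_gt0.
- have E j : flat a j 0 = 0 by rewrite /flat ltxx.
  rewrite !E !mulr0 addr0.
  pose C := (k.+2%:R / a) ^+ k.+2.
  have C0 : 0 <= C by rewrite exprn_ge0// divr_ge0// ltW.
  have cvg0 : h^-1 *: (flat a k (h *: 1 + 0) - flat a k 0) @[h --> 0^'] --> (0 : R).
    apply/cvgrPdist_le => eps eps0; near=> h.
    have h0 : h != 0 by near: h; exact: nbhs_dnbhs_neq.
    rewrite sub0r normrN E subr0 addr0 /GRing.scale/= mulr1 normrM normfV.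
    rewrite ler_pdivrMl ?normr_gt0//.
    apply: le_trans (flat_bound a0 k h) _.
    rewrite -/C -(real_normK (num_real h)) expr2 mulrCA ler_wpM2l//.
    have : `|h| <= eps / (C + 1).
      near: h; apply: dnbhs0_le; rewrite divr_gt0// ltr_wpDl//.
    rewrite ler_pdivlMr ?ltr_wpDl// => hh.
    by apply: le_trans hh; rewrite mulrC ler_wpM2l// lerDl.
  by split; [apply/cvg_ex; exists 0|exact: cvg_lim].
Unshelve. all: by end_near. Qed.

End flat_derivative.

(** * Operations preserving test functions *)

Section test_functions.
Variable R : realType.
Implicit Types (Om : set (R * R)) (f g : R * R -> R).

Lemma test_fun_out Om f x : test_fun Om f -> ~ Om x -> f x = 0.
Proof. by move=> [_ [K [_ KOm K0]]] Ox; apply: K0 => /KOm. Qed.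

(** The same compact set works: it is closed, so f vanishes on a whole neighbourhood of any point
    outside it. *)
Lemma test_fun_partial Om f b : test_fun Om f -> test_fun Om (partial b f).
Proof.
move=> [sf [K [cK KOm K0]]]; split; first exact: smooth_partial.
exists K; split => // x Kx; rewrite -(partial_cst b 0 x) /partial.
have d0 : dir R b != 0.
  by apply/eqP; case: b => /= -[] /eqP; rewrite oner_eq0.
apply: near_eq_derive => //.
have : nbhs x (~` K).
  apply: open_nbhs_nbhs; split => //; apply: closed_openC.
  by apply: compact_closed => //; exact: norm_hausdorff.
by apply: filterS => y /K0.
Qed.

Lemma test_fun_bounded Om f : test_fun Om f ->
  exists2 M : R, 0 <= M & forall x, `|f x| <= M.
Proof.
move=> [sf [K [cK KOm K0]]].
have : compact (f @` K).
  by apply: continuous_compact => //; apply: continuous_subspaceT; exact: smooth_continuous.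
move=> /compact_bounded[M [Mr MK]].
exists (`|M| + 1) => [|x]; first by rewrite addr_ge0.
have [Kx|/K0 ->] := pselect (K x); last by rewrite normr0 addr_ge0.
by apply: (MK (`|M| + 1)); [rewrite (le_lt_trans (ler_norm _))// ltrDl|exists x].
Qed.

Lemma test_fun_comp Om f (h : R -> R) : h 0 = 0 -> smooth (h \o f) ->
  test_fun Om f -> test_fun Om (h \o f).
Proof.
move=> h0 sh [_ [K [cK KOm K0]]]; split => //.
by exists K; split => // x Kx; rewrite /= K0.
Qed.

(** Treats both truncations at once (n = 1 and n = 2). The generators are the iterated partials of f
    and [cutinv e \o f]; the derivative - 2 e t c^2 of c = [cutinv e] shows that they are closed
    under [partial]. *)
Lemma smooth_cut (e : R) f n : 0 < e -> smooth f ->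
  smooth (fun x => f x ^+ n.+1 * cutinv e (f x)).
Proof.
move=> e0 sf.
pose B := [set g | (exists l, g = iter_partial l f) \/ g = cutinv e \o f].
have Bit l : fun_alg B (iter_partial l f) by apply: fun_alg_base; left; exists l.
have Bf : fun_alg B f by exact: (Bit [::]).
have Bc : fun_alg B (cutinv e \o f) by apply: fun_alg_base; right.
apply: (@fun_alg_smooth _ B); last first.
  apply: fun_algM => //; elim: n => // n IH.
  by under eq_fun do rewrite exprS; exact: fun_algM.
move=> g [[l ->]|->]; split.
- by move=> x; apply: smooth_differentiable; exact: smooth_iter_partial.
- by move=> b; exact: (Bit (b :: l)).
- move=> x; apply: (differentiable_comp_fun _ (is_derive_cutinv e0 _)).
  exact: smooth_differentiable.
- move=> b; rewrite (_ : partial b _ = fun x => (- 2 * e) *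
    (f x * ((cutinv e \o f) x * (cutinv e \o f) x) * partial b f x)).
    apply: fun_algM; first exact: fun_alg_cst.
    apply: fun_algM; last exact: (Bit [:: b]).
    by apply: fun_algM => //; exact: fun_algM.
  apply/funext => x; rewrite (partial_comp _ _ (is_derive_cutinv e0 _)).
    by rewrite /=; ring.
  exact: smooth_differentiable.
Qed.

Lemma test_fun_cut2 Om f (e : R) : 0 < e -> test_fun Om f ->
  test_fun Om (cut2 e \o f).
Proof.
move=> e0 tf; apply: test_fun_comp => //; first by rewrite /cut2 expr0n mul0r.
by apply: (@smooth_cut e f 1 e0); case: tf.
Qed.

Lemma test_fun_cut3 Om f (e : R) : 0 < e -> test_fun Om f ->
  test_fun Om (cut3 e \o f).
Proof.
move=> e0 tf; apply: test_fun_comp => //; first by rewrite /cut3 expr0n mul0r.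
by apply: (@smooth_cut e f 2 e0); case: tf.
Qed.

Lemma smoothZ (c : R) f : smooth f -> smooth (fun x => c * f x).
Proof.
move=> sf; pose B := [set g | (exists l, g = iter_partial l f)].
have Bit l : fun_alg B (iter_partial l f) by apply: fun_alg_base; exists l.
apply: (@fun_alg_smooth _ B); last first.
  by apply: fun_algM; [exact: fun_alg_cst|exact: (Bit [::])].
move=> g [l ->]; split; first by move=> x; apply: smooth_differentiable; apply: smooth_iter_partial.
by move=> b; exact: (Bit (b :: l)).
Qed.

Lemma test_funZ Om (c : R) f : test_fun Om f -> test_fun Om (fun x => c * f x).
Proof.
move=> tf; apply: (@test_fun_comp Om f ( *%R c)) => //; first by rewrite mulr0.
by apply: smoothZ; case: tf.
Qed.

Lemma partialZ b (c : R) f x : differentiable f x ->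
  partial b (fun x => c * f x) x = c * partial b f x.
Proof.
move=> df; rewrite partialM ?partial_cst ?mulr0 ?addr0//.
Qed.

End test_functions.

(** * Square-integrable functions *)

Section square_integrable.
Context (d : measure_display) (T : measurableType d) (R : realType).
Variables (mu : {measure set T -> \bar R}) (D : set T).
Hypothesis mD : measurable D.
Hypothesis muD : (mu D < +oo)%E.
Implicit Types f g h : T -> R.

Definition L2 f := measurable_fun D f /\
  mu.-integrable D (EFin \o (fun x => f x ^+ 2)).

Local Notation itg f := (mu.-integrable D (EFin \o f)).
Local Notation I f := (\int[mu]_(x in D) f x)%R.

Lemma integrable_funD f g : itg f -> itg g -> itg (fun x => f x + g x).
Proof. exact: integrableD. Qed.

Lemma integrable_funB f g : itg f -> itg g -> itg (fun x => f x - g x).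
Proof. exact: integrableB. Qed.

Lemma integrable_funZ (c : R) f : itg f -> itg (fun x => c * f x).
Proof. exact: integrableZl. Qed.

Lemma integrable_bounded f (M : R) : measurable_fun D f ->
  (forall x, D x -> `|f x| <= M) -> itg f.
Proof.
move=> mf fM; apply: measurable_bounded_integrable => //.
by exists M; split; rewrite ?num_real// => y My x /= /fM /le_trans; apply; exact: ltW.
Qed.

Lemma L2_bounded f (M : R) : measurable_fun D f ->
  (forall x, D x -> `|f x| <= M) -> L2 f.
Proof.
move=> mf fM; split => //; apply: (@integrable_bounded _ (M ^+ 2)).
  exact: measurable_funX.
move=> x /fM h; rewrite normrX lerXn2r ?nnegrE//.
exact: le_trans h.
Qed.

Lemma L2_cst (c : R) : L2 (fun=> c).
Proof. by apply: (@L2_bounded _ `|c|) => // x _; exact: lexx. Qed.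

Lemma L2M_integrable f g : L2 f -> L2 g -> itg (fun x => f x * g x).
Proof.
move=> [mf f2] [mg g2].
apply: le_integrable (integrable_funD f2 g2) => //.
  by apply/measurable_EFinP; exact: measurable_funM.
move=> x Dx; rewrite /= lee_fin [leRHS]ger0_norm ?addr_ge0 ?sqr_ge0//.
rewrite normrM; have := sqr_ge0 (`|f x| - `|g x|).
by rewrite sqrrB !real_normK ?num_real//; nra.
Qed.

Lemma L2_integrable f : L2 f -> itg f.
Proof.
move=> f2; have := L2M_integrable (L2_cst 1) f2.
by under eq_fun do rewrite mul1r.
Qed.

Lemma L2_integralE f : L2 f ->
  (\int[mu]_(x in D) (f x ^+ 2)%:E = (I (fun x => f x ^+ 2))%:E)%E.
Proof. by move=> [_ f2]; rewrite fineK//; exact: integrable_fin_num. Qed.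

Lemma L2D f g : L2 f -> L2 g -> L2 (fun x => f x + g x).
Proof.
move=> f2 g2; have fg := L2M_integrable f2 g2.
case: f2 g2 => mf f2 [mg g2].
split; first exact: measurable_funD.
have -> : (fun x => (f x + g x) ^+ 2) =
  (fun x => f x ^+ 2 + (2 * (f x * g x) + g x ^+ 2)).
  by apply/funext => x; ring.
by apply: integrable_funD => //; apply: integrable_funD => //; exact: integrable_funZ.
Qed.

Lemma L2Z (c : R) f : L2 f -> L2 (fun x => c * f x).
Proof.
move=> [mf f2]; split; first by apply: measurable_funM => //; exact: measurable_cst.
have -> : (fun x => (c * f x) ^+ 2) = (fun x => c ^+ 2 * f x ^+ 2).
  by apply/funext => x; ring.
exact: integrable_funZ.
Qed.

Lemma L2B f g : L2 f -> L2 g -> L2 (fun x => f x - g x).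
Proof.
move=> f2 g2; have := L2D f2 (L2Z (-1) g2).
by under eq_fun do rewrite mulN1r.
Qed.

Lemma L2_le f g : measurable_fun D f -> L2 g ->
  (forall x, D x -> `|f x| <= `|g x|) -> L2 f.
Proof.
move=> mf [mg g2] fg; split => //; apply: le_integrable g2 => //.
  by apply/measurable_EFinP; exact: measurable_funX.
by move=> x /fg h; rewrite /= lee_fin !normrX lerXn2r ?nnegrE.
Qed.

Lemma Cauchy_Schwarz f g : L2 f -> L2 g ->
  I (fun x => f x * g x) ^+ 2 <= I (fun x => f x ^+ 2) * I (fun x => g x ^+ 2).
Proof.
move=> f2 g2; have fg := L2M_integrable f2 g2.
have [_ ff] := f2; have [_ gg] := g2.
set a := I (fun x => f x ^+ 2); set b := I (fun x => f x * g x); set c := I (fun x => g x ^+ 2).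
have a0 : 0 <= a by apply: Rintegral_ge0 => x _; exact: sqr_ge0.
have c0 : 0 <= c by apply: Rintegral_ge0 => x _; exact: sqr_ge0.
have q s t : 0 <= s ^+ 2 * a + 2 * s * t * b + t ^+ 2 * c.
  have -> : s ^+ 2 * a + 2 * s * t * b + t ^+ 2 * c =
      I (fun x => (s * f x + t * g x) ^+ 2).
    rewrite (_ : (fun x => _) = (fun x => s ^+ 2 * f x ^+ 2 +
      (2 * s * t * (f x * g x) + t ^+ 2 * g x ^+ 2))); last first.
      by apply/funext => x; ring.
    rewrite RintegralD// ?RintegralD// ?RintegralZl// ?addrA//.
    - exact: integrable_funZ.
    - exact: integrable_funZ.
    - exact: integrable_funZ.
    - by apply: integrable_funD; exact: integrable_funZ.
  by apply: Rintegral_ge0 => x _; exact: sqr_ge0.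
have [c1|c1] := ltP 0 c.
  have := q c (- b); rewrite sqrrN.
  have -> : c ^+ 2 * a + 2 * c * - b * b + b ^+ 2 * c = c * (a * c - b ^+ 2) by ring.
  by rewrite pmulr_rge0// subr_ge0.
have c_0 : c = 0 by apply/eqP; rewrite eq_le c1.
(* With c = 0 these values make the quadratic form equal to - 2 b^2, hence b = 0. *)
have := q (- b) (a / 2 + 1); have := sqr_ge0 b; rewrite c_0; nra.
Qed.

Lemma cvg_sq_le (x y : R^nat) : (forall n, x n ^+ 2 <= y n) ->
  y @ \oo --> 0 -> x @ \oo --> 0.
Proof.
move=> xy y0; apply/cvgrPdist_lt => e e0.
move/cvgrPdist_lt : y0 => /(_ (e ^+ 2) (exprn_gt0 2 e0)).
apply: filterS => n; rewrite !sub0r !normrN => h.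
rewrite -(@ltr_pXn2r _ 2)// ?nnegrE// ?ltW// real_normK ?num_real//.
exact: le_lt_trans (xy n) (le_lt_trans (ler_norm _) h).
Qed.

Lemma cvg_L2M0 (f g : nat -> T -> R) (C : R) : (forall n, L2 (f n)) ->
  (forall n, L2 (g n)) -> (fun n => I (fun x => f n x ^+ 2)) @ \oo --> 0 ->
  (forall n, I (fun x => g n x ^+ 2) <= C) ->
  (fun n => I (fun x => f n x * g n x)) @ \oo --> 0.
Proof.
move=> f2 g2 f0 gC.
apply: (@cvg_sq_le _ (fun n => I (fun x => f n x ^+ 2) * C)).
  move=> n; apply: le_trans (Cauchy_Schwarz (f2 n) (g2 n)) _.
  by rewrite ler_wpM2l// Rintegral_ge0// => x _; exact: sqr_ge0.
by rewrite -(mul0r C); apply: cvgMl.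
Qed.

(** Writing f_n g_n - f' g' as (f_n - f')(g_n - g') + (g_n - g') f' + (f_n - f') g', each term has
    one factor tending to 0 in L^2 and the other bounded there. *)
Lemma cvg_L2M (f g : nat -> T -> R) f' g' : (forall n, L2 (f n)) ->
  (forall n, L2 (g n)) -> L2 f' -> L2 g' ->
  (fun n => I (fun x => (f n x - f' x) ^+ 2)) @ \oo --> 0 ->
  (fun n => I (fun x => (g n x - g' x) ^+ 2)) @ \oo --> 0 ->
  (fun n => I (fun x => f n x * g n x)) @ \oo --> I (fun x => f' x * g' x).
Proof.
move=> f2 g2 f'2 g'2 cf cg.
have df n := L2B (f2 n) f'2; have dg n := L2B (g2 n) g'2.
have bnd : cvgn (fun n => I (fun x => (g n x - g' x) ^+ 2)) by apply/cvg_ex; exists 0.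
have [C [_ HC]] := cvg_seq_bounded bnd.
have h1 : (fun n => I (fun x => (f n x - f' x) * (g n x - g' x))) @ \oo --> 0.
  apply: (@cvg_L2M0 _ _ (C + 1)) => // n.
  by apply: le_trans (ler_norm _) (HC _ _ n _) => //; rewrite ltrDl.
have h2 : (fun n => I (fun x => (g n x - g' x) * f' x)) @ \oo --> 0.
  by apply: (@cvg_L2M0 _ (fun=> f') (I (fun x => f' x ^+ 2))).
have h3 : (fun n => I (fun x => (f n x - f' x) * g' x)) @ \oo --> 0.
  by apply: (@cvg_L2M0 _ (fun=> g') (I (fun x => g' x ^+ 2))).
suff : (fun n => I (fun x => f n x * g n x)) @ \oo -->
    0 + 0 + (0 + I (fun x => f' x * g' x)) by rewrite !add0r.
rewrite (_ : (fun n => _) = (fun n =>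
  I (fun x => (f n x - f' x) * (g n x - g' x)) +
  I (fun x => (g n x - g' x) * f' x) +
  (I (fun x => (f n x - f' x) * g' x) + I (fun x => f' x * g' x)))).
  by apply: cvgD; apply: cvgD => //; exact: cvg_cst.
apply/funext => n; rewrite -!RintegralD//.
- by apply: eq_Rintegral => x _; ring.
- by apply: integrable_funD; exact: L2M_integrable.
- by apply: integrable_funD; exact: L2M_integrable.
- exact: L2M_integrable.
- exact: L2M_integrable.
- exact: L2M_integrable.
- exact: L2M_integrable.
Qed.

Lemma cvg_L2X (f : nat -> T -> R) f' : (forall n, L2 (f n)) -> L2 f' ->
  (fun n => I (fun x => (f n x - f' x) ^+ 2)) @ \oo --> 0 ->
  (fun n => I (fun x => f n x ^+ 2)) @ \oo --> I (fun x => f' x ^+ 2).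
Proof.
move=> f2 f'2 cf; have := cvg_L2M f2 f2 f'2 f'2 cf cf.
have E g : I (fun x => g x * g x) = I (fun x => g x ^+ 2) by [].
by rewrite E; under eq_fun do rewrite E.
Qed.

Lemma cvg_L2 (f : nat -> T -> R) f' : (forall n, L2 (f n)) -> L2 f' ->
  (fun n => I (fun x => (f n x - f' x) ^+ 2)) @ \oo --> 0 ->
  (fun n => I (f n)) @ \oo --> I f'.
Proof.
move=> f2 f'2 cf.
have := @cvg_L2M f (fun=> fun=> 1) f' (fun=> 1) f2 (fun=> L2_cst 1) f'2 (L2_cst 1) cf.
have E g : I (fun x => g x * 1) = I g by apply: eq_Rintegral => x _; rewrite mulr1.
rewrite E (_ : (fun n => I (fun x => f n x * 1)) = fun n => I (f n)); last first.
  by apply/funext => n.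
apply; rewrite [X in X @ _](_ : _ = fun=> 0); first exact: cvg_cst.
apply/funext => n; rewrite Rintegral_cst//.
by rewrite subrr expr0n mul0r.
Qed.

Lemma Rintegral_sqD_ge f g : L2 f -> L2 g ->
  I (fun x => f x ^+ 2) <= I (fun x => f x ^+ 2 + g x ^+ 2) /\
  I (fun x => g x ^+ 2) <= I (fun x => f x ^+ 2 + g x ^+ 2).
Proof.
move=> [_ f2] [_ g2]; have fg := integrable_funD f2 g2.
by split; apply: le_Rintegral => // x _; rewrite ?lerDl ?lerDr sqr_ge0.
Qed.

Lemma Rintegral_sqM_le f h (c : R) : L2 f -> L2 (fun x => h x * f x) ->
  (forall x, 0 <= h x <= c) ->
  I (fun x => (h x * f x) ^+ 2) <= c ^+ 2 * I (fun x => f x ^+ 2).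
Proof.
move=> [_ f2] [_ hf2] hc; rewrite -RintegralZl//; apply: le_Rintegral => //.
  exact: integrable_funZ.
move=> x _; rewrite exprMn ler_wpM2r ?sqr_ge0//.
by have /andP[h0 h1] := hc x; rewrite lerXn2r ?nnegrE// (le_trans h0).
Qed.

Lemma Rintegral_le_scale f g (c : R) : L2 f -> L2 g ->
  (forall x, f x ^+ 2 <= c * g x ^+ 2) ->
  I (fun x => f x ^+ 2) <= c * I (fun x => g x ^+ 2).
Proof.
move=> [_ f2] [_ g2] fg; rewrite -RintegralZl//; apply: le_Rintegral => //.
exact: integrable_funZ.
Qed.

Lemma Rintegral_penalized f p (lam M : R) : L2 f -> L2 p ->
  I (fun x => (lam * p x) ^+ 2 + M * (lam * f x - 1) ^+ 2) =
  lam ^+ 2 * I (fun x => p x ^+ 2) +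
  M * (lam ^+ 2 * I (fun x => f x ^+ 2) - 2 * lam * I f + fine (mu D)).
Proof.
move=> fL2 [_ i1]; have i3 := L2_integrable fL2; have [_ i2] := fL2.
have i4 := L2_integrable (L2_cst 1).
have j1 := integrable_funZ (lam ^+ 2) i1.
have j2 := integrable_funZ (lam ^+ 2) i2.
have j3 := integrable_funZ (2 * lam) i3.
have j23 := integrable_funB j2 j3.
have j234 := integrable_funD j23 i4.
have j5 := integrable_funZ M j234.
rewrite (@eq_Rintegral _ _ _ mu D (fun x => lam ^+ 2 * p x ^+ 2 +
   M * (lam ^+ 2 * f x ^+ 2 - 2 * lam * f x + 1))); last by move=> x _; ring.
rewrite RintegralD// RintegralZl// RintegralZl// RintegralD// RintegralB//.
by rewrite !RintegralZl// Rintegral_cst// mul1r.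
Qed.

(* [K] and [G] stand for truncations of [f^2] and [f^3], [p] and [q] for the
   partial derivatives of [f], [(g1, g2)] for the weak gradient of the torsion
   function; the last two terms of the bound are error terms. *)
Lemma truncated_moment_le f K G p q Kp Kq Gp Gq g1 g2 (lam : R) : 0 < lam ->
  L2 f -> L2 K -> L2 G -> L2 p -> L2 q -> L2 Kp -> L2 Kq -> L2 Gp -> L2 Gq ->
  L2 g1 -> L2 g2 ->
  lam * I (fun x => K x ^+ 2) <= I (fun x => Kp x ^+ 2 + Kq x ^+ 2) ->
  I (fun x => g1 x * Gp x + g2 x * Gq x) = I G ->
  (forall x, Kp x ^+ 2 + Kq x ^+ 2 <= 4 / 3 * (p x * Gp x + q x * Gq x)) ->
  (forall x, G x = K x * f x) ->
  lam / 2 * I (fun x => K x ^+ 2) <= 8 / (9 * lam) * I (fun x => f x ^+ 2) +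
    4 / 3 * (I (fun x => (p x - g1 x) * Gp x) + I (fun x => (q x - g2 x) * Gq x)).
Proof.
move=> lam0 fL KL GL pL qL KpL KqL GpL GqL g1L g2L ray weak KG GE.
have iK := KL.2; have iG := L2_integrable GL.
have pG := L2M_integrable pL GpL; have qG := L2M_integrable qL GqL.
have gG1 := L2M_integrable g1L GpL; have gG2 := L2M_integrable g2L GqL.
have d1 := L2M_integrable (L2B pL g1L) GpL.
have d2 := L2M_integrable (L2B qL g2L) GqL.
have up : I (fun x => Kp x ^+ 2 + Kq x ^+ 2) <=
    4 / 3 * I (fun x => p x * Gp x + q x * Gq x).
  rewrite -RintegralZl//; last exact: integrable_funD.
  apply: le_Rintegral => //; first by apply: integrable_funD; [case: KpL|case: KqL].
  by apply: integrable_funZ => //; exact: integrable_funD.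
have split1 : I (fun x => p x * Gp x + q x * Gq x) =
    I G + (I (fun x => (p x - g1 x) * Gp x) + I (fun x => (q x - g2 x) * Gq x)).
  rewrite -weak -!RintegralD//.
  - by apply: eq_Rintegral => x _; ring.
  - exact: integrable_funD.
  - exact: integrable_funD.
(* Young's inequality for G = K f, weighted so that exactly half of the left side [lam * I (K^2)] of
   the Rayleigh inequality is absorbed. *)
have ag : 4 / 3 * I G <= lam / 2 * I (fun x => K x ^+ 2) +
    8 / (9 * lam) * I (fun x => f x ^+ 2).
  have if2 := fL.2.
  rewrite -!RintegralZl// -RintegralD//; last 2 first.
  - exact: integrable_funZ.
  - exact: integrable_funZ.
  apply: le_Rintegral => //; first exact: integrable_funZ.
    by apply: integrable_funD; exact: integrable_funZ.
  move=> x _; rewrite GE; set k := K x; set t := f x.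
  have sq := sqr_ge0 (lam * k - 4 / 3 * t).
  have -> : lam / 2 * k ^+ 2 + 8 / (9 * lam) * t ^+ 2 =
    4 / 3 * (k * t) + (lam * k - 4 / 3 * t) ^+ 2 / (2 * lam).
    by field; rewrite gt_eqF.
  by rewrite lerDl divr_ge0// mulr_ge0// ltW.
move: ray up ag; rewrite split1; lra.
Qed.

End square_integrable.

(** * [H01] and [lambda1] on an open set of finite area *)

Section planar_domain.
Variables (R : realType) (Om : set (R * R)).
Hypothesis oOm : open Om.
Hypothesis finOm : (leb2 R Om < +oo)%E.
Implicit Types (phi f : R * R -> R).

Local Notation mu := (leb2 R).
Local Notation planeT := (setT : set (measurableTypeR R * measurableTypeR R)).
Local Notation I f := (\int[mu]_(x in Om) f x)%R.

Let mOm : measurable (Om : set (measurableTypeR R * measurableTypeR R)).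
Proof. exact: open_measurable_plane. Qed.

Lemma test_fun_measurable phi D : test_fun Om phi ->
  measurable_fun (D : set (measurableTypeR R * measurableTypeR R)) phi.
Proof.
move=> [sp _]; apply: measurable_funTS.
by apply: continuous_measurable_plane; exact: smooth_continuous.
Qed.

Lemma test_fun_L2 phi : test_fun Om phi -> L2 mu Om phi.
Proof.
move=> tp; have [M _ pM] := test_fun_bounded tp.
by apply: (@L2_bounded _ _ _ _ _ mOm finOm phi M) => //; exact: test_fun_measurable.
Qed.

Lemma test_fun_H01 phi : test_fun Om phi ->
  H01 Om phi (partial false phi) (partial true phi).
Proof.
move=> tp; split; try exact: test_fun_measurable (test_fun_partial _ tp).
  exact: test_fun_measurable tp.
exists (fun=> phi); split => //.
have s0 f : sqL2 (fun x => f x - f x) = 0%E :> \bar R.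
  by rewrite /sqL2; apply: integral0_eq => x _; rewrite subrr expr0n.
by rewrite !s0 !adde0; exact: cvg_cst.
Qed.

(** Replaces the single extended-real limit over the whole plane by three real limits over [Om];
    this requires the errors to be finite, which holds from some index on. *)
Lemma H01_approx u g1 g2 : H01 Om u g1 g2 ->
  [/\ L2 mu Om u, L2 mu Om g1, L2 mu Om g2 &
   exists phi : nat -> R * R -> R, [/\ forall n, test_fun Om (phi n),
     (fun n => I (fun x => (phi n x - u x) ^+ 2)) @ \oo --> 0,
     (fun n => I (fun x => (partial false (phi n) x - g1 x) ^+ 2)) @ \oo --> 0 &
     (fun n => I (fun x => (partial true (phi n) x - g2 x) ^+ 2)) @ \oo --> 0]].
Proof.
move=> [mu_ mg1 mg2 [phi [tphi]]].
have sq0 f : (0 <= sqL2 f)%E by apply: integral_ge0 => x _; rewrite lee_fin sqr_ge0.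
have msq (f g : R * R -> R) : measurable_fun planeT f ->
    measurable_fun planeT g ->
    measurable_fun planeT
      (fun x => ((f x - g x) ^+ 2)).
  by move=> mf mg; apply: measurable_funX; exact: measurable_funB.
have Isq (f g : R * R -> R) : measurable_fun planeT f ->
    measurable_fun planeT g ->
    (\int[mu]_(x in Om) ((f x - g x) ^+ 2)%:E <= sqL2 (fun x => (f x - g x)%R))%E.
  move=> mf mg; apply: ge0_subset_integral => //.
    by apply/measurable_EFinP; exact: msq.
  by move=> x _; rewrite lee_fin sqr_ge0.
set s := (X in X @ _ --> _) => cs.
have sfin := cvg_is_fine cs.
have fs0 : fine \o s @ \oo --> 0 by exact: fine_cvg cs.
have [N _ HN] := sfin.
have mphi n : measurable_fun planeT (phi n) := test_fun_measurable (tphi n).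
have mpp n b : measurable_fun planeT (partial b (phi n)) :=
  test_fun_measurable (test_fun_partial b (tphi n)).
have ss n : [/\ (sqL2 (fun x => (phi n x - u x)%R) <= s n)%E,
    (sqL2 (fun x => (partial false (phi n) x - g1 x)%R) <= s n)%E &
    (sqL2 (fun x => (partial true (phi n) x - g2 x)%R) <= s n)%E].
  split; rewrite /s.
  - by rewrite -addeA leeDl// adde_ge0.
  - by rewrite addeAC leeDr// adde_ge0.
  - by rewrite leeDr// adde_ge0.
(* One index with finite error is enough for square integrability, since g = f - (f - g). *)
have key (f g : R * R -> R) : L2 mu Om f ->
    measurable_fun planeT f ->
    measurable_fun planeT g ->
    (exists2 n, (N <= n)%N & (sqL2 (fun x => (f x - g x)%R) <= s n)%E) -> L2 mu Om g.
  move=> f2 mf mg [n Nn fgs].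
  have fg2 : L2 mu Om (fun x => f x - g x).
    split; first by apply: measurable_funTS; exact: measurable_funB.
    apply/integrableP; split.
      by apply/measurable_EFinP; apply: measurable_funTS; exact: msq.
    under eq_integral do rewrite /= ger0_norm ?sqr_ge0//.
    apply: le_lt_trans (Isq _ _ mf mg) _; apply: le_lt_trans fgs _.
    by rewrite ltey_eq; apply/orP; left; exact: HN.
  have := L2B mOm f2 fg2.
  by under eq_fun do rewrite subKr.
have lim (f : nat -> R * R -> R) (g : R * R -> R) : (forall n, measurable_fun planeT (f n)) ->
    measurable_fun planeT g ->
    (forall n, sqL2 (fun x => (f n x - g x)%R) <= s n)%E ->
    (fun n => I (fun x => (f n x - g x) ^+ 2)) @ \oo --> 0.
  move=> mf mg fs; apply: (squeeze_cvgr _ (cvg_cst 0) fs0).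
  near=> n; have sn : s n \is a fin_num by near: n; exact: sfin.
  rewrite Rintegral_ge0/=; last by move=> x _; exact: sqr_ge0.
  apply: fine_le => //; last exact: le_trans (Isq _ _ (mf n) mg) (fs n).
  rewrite ge0_fin_numE; last by apply: integral_ge0 => x _; rewrite lee_fin sqr_ge0.
  apply: le_lt_trans (Isq _ _ (mf n) mg) (le_lt_trans (fs n) _).
  by rewrite ltey_eq sn.
split.
- apply: (key (phi N)) => //; first exact: test_fun_L2.
  by exists N => //; case: (ss N).
- apply: (key (partial false (phi N))) => //.
    by apply: test_fun_L2; exact: test_fun_partial.
  by exists N => //; case: (ss N).
- apply: (key (partial true (phi N))) => //.
    by apply: test_fun_L2; exact: test_fun_partial.
  by exists N => //; case: (ss N).
exists phi; split => //; apply: lim => // n; by case: (ss n).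
Unshelve. all: by end_near. Qed.

Lemma lambda1_ge0 : (0 <= lambda1 Om)%E.
Proof.
apply: le_ereal_inf_tmp => _ [u [g1 [g2 [_ _ ->]]]]; rewrite lee_fin divr_ge0// fine_ge0//.
  by apply: integral_ge0 => x _; rewrite lee_fin addr_ge0 ?sqr_ge0.
by apply: integral_ge0 => x _; rewrite lee_fin sqr_ge0.
Qed.

Lemma lambda1_le phi : test_fun Om phi -> 0 < I (fun x => phi x ^+ 2) ->
  (lambda1 Om <= (I (fun x => partial false phi x ^+ 2 + partial true phi x ^+ 2)
                  / I (fun x => phi x ^+ 2))%:E)%E.
Proof.
move=> tp p0; apply: ereal_inf_lbound; exists phi, (partial false phi), (partial true phi).
split => //; first exact: test_fun_H01.
by apply/eqP => h; move: p0; rewrite /Rintegral [X in fine X]h ltxx.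
Qed.

(** Passing to [fine] is harmless: a test function of positive mass bounds [lambda1 Om] by a real
    number, and for zero mass the left side is 0. *)
Lemma Rayleigh phi : test_fun Om phi ->
  fine (lambda1 Om) * I (fun x => phi x ^+ 2) <=
  I (fun x => partial false phi x ^+ 2 + partial true phi x ^+ 2).
Proof.
move=> tp; have E0 : 0 <= I (fun x => partial false phi x ^+ 2 + partial true phi x ^+ 2).
  by apply: Rintegral_ge0 => x _; rewrite addr_ge0 ?sqr_ge0.
have a0 : 0 <= I (fun x => phi x ^+ 2) by apply: Rintegral_ge0 => x _; rewrite sqr_ge0.
move: a0; rewrite le_eqVlt => /predU1P[<-|a0]; first by rewrite mulr0.
have := lambda1_le tp a0; have := lambda1_ge0.
case: (lambda1 Om) => [r _| _|//]; last by rewrite leye_eq.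
by rewrite lee_fin ler_pdivlMr.
Qed.

End planar_domain.

(** * Estimates for the torsion function *)

Section torsion_estimates.
Variables (R : realType) (Om : set (R * R)).
Hypothesis oOm : open Om.
Hypothesis finOm : (leb2 R Om < +oo)%E.
Variables (v g1 g2 : R * R -> R) (lam : R).
Hypothesis tv : torsion Om v g1 g2.
Hypothesis lam0 : 0 <= lam.

Local Notation mu := (leb2 R).
Local Notation I f := (\int[mu]_(x in Om) f x)%R.
Local Notation dx := (partial false).
Local Notation dy := (partial true).

Hypothesis ray : forall phi, test_fun Om phi ->
  lam * I (fun x => phi x ^+ 2) <= I (fun x => dx phi x ^+ 2 + dy phi x ^+ 2).

Let mOm : measurable (Om : set (measurableTypeR R * measurableTypeR R)).
Proof. exact: open_measurable_plane. Qed.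

Let itM f g (Hf : L2 mu Om f) (Hg : L2 mu Om g) :
  mu.-integrable Om (EFin \o (fun x => f x * g x)) := L2M_integrable mOm Hf Hg.

Let itX f (Hf : L2 mu Om f) :
  mu.-integrable Om (EFin \o (fun x => f x ^+ 2)) := Hf.2.

Let testL2 f (Hf : test_fun Om f) : L2 mu Om f := test_fun_L2 oOm finOm Hf.

Let partL2 b f (Hf : test_fun Om f) : L2 mu Om (partial b f) :=
  testL2 (test_fun_partial b Hf).

Lemma torsion_L2 : L2 mu Om v.
Proof. by case: tv => /(H01_approx oOm finOm)[]. Qed.

Lemma torsion_weak phi : test_fun Om phi ->
  I (fun x => g1 x * dx phi x + g2 x * dy phi x) = I phi.
Proof. by move=> tp; case: tv => _ /(_ _ tp) h; rewrite /Rintegral; congr fine. Qed.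

(* The estimates below only need the approximating test functions: no chain
   rule in [H01] is used. *)
Lemma torsion_sequence : exists phi : nat -> R * R -> R,
  [/\ forall n, test_fun Om (phi n),
     (fun n => I (fun x => (phi n x - v x) ^+ 2)) @ \oo --> 0,
     (fun n => I (fun x => (dx (phi n) x - g1 x) ^+ 2)) @ \oo --> 0,
     (fun n => I (fun x => (dy (phi n) x - g2 x) ^+ 2)) @ \oo --> 0 &
     (fun n => I (fun x => dx (phi n) x ^+ 2 + dy (phi n) x ^+ 2)) @ \oo --> I v].
Proof.
have [h01 _] := tv; have [v2 g12 g22 [phi [tp c0 c1 c2]]] := H01_approx oOm finOm h01.
exists phi; split => //.
have tpx n := partL2 false (tp n); have tpy n := partL2 true (tp n).
have ex := cvg_L2X mOm tpx g12 c1.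
have ey := cvg_L2X mOm tpy g22 c2.
have z1 : (fun=> I (fun x => (g1 x - g1 x) ^+ 2)) @ \oo --> 0.
  rewrite (_ : (fun=> _) = fun=> 0); first exact: cvg_cst.
  apply/funext => _; rewrite (@eq_Rintegral _ _ _ _ _ (fun=> 0)) ?Rintegral_cst ?mul0r//.
  by move=> x _; rewrite subrr expr0n.
have z2 : (fun=> I (fun x => (g2 x - g2 x) ^+ 2)) @ \oo --> 0.
  rewrite (_ : (fun=> _) = fun=> 0); first exact: cvg_cst.
  apply/funext => _; rewrite (@eq_Rintegral _ _ _ _ _ (fun=> 0)) ?Rintegral_cst ?mul0r//.
  by move=> x _; rewrite subrr expr0n.
have fx := @cvg_L2M _ _ _ _ _ mOm (fun=> g1) (fun n => (dx (phi n))) g1 g1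
  (fun=> g12) tpx g12 g12 z1 c1.
have fy := @cvg_L2M _ _ _ _ _ mOm (fun=> g2) (fun n => (dy (phi n))) g2 g2
  (fun=> g22) tpy g22 g22 z2 c2.
have b := cvg_L2 mOm finOm (fun n => testL2 (tp n)) v2 c0.
(* The energy identity int |Dv|^2 = int v: the weak equation is tested with [phi n], and both of its
   sides converge. *)
have E : I v = I (fun x => g1 x * g1 x) + I (fun x => g2 x * g2 x).
  rewrite -(cvg_lim (@Rhausdorff R) b); apply: cvg_lim; first exact: Rhausdorff.
  rewrite (_ : (fun n => I (phi n)) = fun n =>
     I (fun x => g1 x * dx (phi n) x) + I (fun x => g2 x * dy (phi n) x)).
    exact: cvgD.
  by apply/funext => n; rewrite -RintegralD ?torsion_weak//; apply: itM.
rewrite E; have Ee n : I (fun x => dx (phi n) x ^+ 2 + dy (phi n) x ^+ 2) =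
    I (fun x => dx (phi n) x ^+ 2) + I (fun x => dy (phi n) x ^+ 2).
  by rewrite RintegralD//; apply: itX.
by under eq_fun do rewrite Ee; exact: cvgD ex ey.
Qed.

Lemma torsion_sq_cvg phi : (forall n, test_fun Om (phi n)) ->
  (fun n => I (fun x => (phi n x - v x) ^+ 2)) @ \oo --> 0 ->
  (fun n => I (fun x => phi n x ^+ 2)) @ \oo --> I (fun x => v x ^+ 2).
Proof.
move=> tp c0; have t2 n := testL2 (tp n).
by have := cvg_L2X mOm t2 torsion_L2; apply.
Qed.

(** In terms of w this is int w^2 <= int w. It is the limit of the Rayleigh inequality along
    [phi n], whose energies tend to int v. *)
Lemma torsion_Rayleigh : lam * I (fun x => v x ^+ 2) <= I v.
Proof.
have [phi [tp c0 c1 c2 e]] := torsion_sequence.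
have a := torsion_sq_cvg tp c0.
apply: (ler_cvg_to (cvgM (cvg_cst lam) a) e).
by near=> n; exact: ray.
Unshelve. all: by end_near. Qed.

(** The hypothesis is applied to [lam * phi n], which approximates w. The single partial derivative
    is bounded by the full gradient, whose energy has the known limit int v. *)
Lemma slice_limit b k M : 0 <= M ->
  (forall phi, test_fun Om phi ->
    k * fine (mu Om) <= I (fun x => partial b phi x ^+ 2 + M * (phi x - 1) ^+ 2)) ->
  k * fine (mu Om) <= lam ^+ 2 * I v +
    M * (lam ^+ 2 * I (fun x => v x ^+ 2) - 2 * lam * I v + fine (mu Om)).
Proof.
move=> M0 slice; have [phi [tp c0 c1 c2 e]] := torsion_sequence.
have a := torsion_sq_cvg tp c0.
have bb := cvg_L2 mOm finOm (fun n => testL2 (tp n)) torsion_L2 c0.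
have L : (fun n => lam ^+ 2 * I (fun x => dx (phi n) x ^+ 2 + dy (phi n) x ^+ 2) +
    M * (lam ^+ 2 * I (fun x => phi n x ^+ 2) - 2 * lam * I (phi n) + fine (mu Om)))
  @ \oo --> lam ^+ 2 * I v +
    M * (lam ^+ 2 * I (fun x => v x ^+ 2) - 2 * lam * I v + fine (mu Om)).
  apply: (cvgD (cvgM (cvg_cst _) e)); apply: (cvgM (cvg_cst _)).
  exact: (cvgD (cvgB (cvgM (cvg_cst _) a) (cvgM (cvg_cst _) bb)) (cvg_cst _)).
apply: (ler_cvg_to (cvg_cst _) L); near=> n.
apply: le_trans (slice _ (test_funZ lam (tp n))) _.
have t2 := testL2 (tp n); have p2 b' := partL2 b' (tp n).
rewrite (@eq_Rintegral _ _ _ mu Om (fun x => (lam * partial b (phi n) x) ^+ 2 +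
   M * (lam * phi n x - 1) ^+ 2)); last first.
  by move=> x _; rewrite partialZ//; apply: smooth_differentiable; case: (tp n).
rewrite (Rintegral_penalized mOm finOm lam M t2 (p2 b)).
rewrite lerD2r ler_wpM2l ?sqr_ge0//.
have [h1 h2] := Rintegral_sqD_ge mOm (p2 false) (p2 true).
by case: (b); [exact: h2|exact: h1].
Unshelve. all: by end_near. Qed.

Lemma torsion_cut2_L2 (e : R) : 0 < e -> L2 mu Om (cut2 e \o v).
Proof.
move=> e0; have v2 := torsion_L2; have mv : measurable_fun Om v by case: v2.
(* The Lipschitz constant of [cut2 e] is at most the square root of e^-1; the factor 1 + e^-1
   exceeds it and avoids the root. *)
apply: (@L2_le _ _ _ _ _ mOm _ (fun x => (1 + e^-1) * v x)) => //.
- apply: measurableT_comp => //; apply: continuous_measurable_fun => t.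
  apply: differentiable_continuous; apply/derivable1_diffP.
  by case: (is_derive_cut2 e0 t).
- exact: L2Z.
- move=> x _ /=; have e1 : 0 < e^-1 by rewrite invr_gt0.
  rewrite -(@ler_pXn2r _ 2)// ?nnegrE// !real_normK ?num_real// [leRHS]exprMn.
  have := cut2_lip e0 (v x) 0.
  have -> : cut2 e 0 = 0 by rewrite cut2_0.
  rewrite !subr0 => /le_trans; apply.
  by rewrite ler_wpM2r ?sqr_ge0//; nra.
Qed.

(** For fixed e the truncated estimate is applied to each [phi n]. Its error terms pair D(phi n) -
    Dv, which tends to 0 in L^2, with the gradient of [cut3 e \o phi n], bounded in L^2 through the
    bound 3 / e on the derivative of [cut3 e]. *)
Lemma torsion_cut (e : R) : 0 < lam -> 0 < e ->
  lam ^+ 2 * I (fun x => cut2 e (v x) ^+ 2) <= 16 / 9 * I (fun x => v x ^+ 2).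
Proof.
move=> lam1 e0; have [phi [tp c0 c1 c2 E]] := torsion_sequence.
have [h01 _] := tv; have [v2 g12 g22 _] := H01_approx oOm finOm h01.
have a := torsion_sq_cvg tp c0.
have tp2 n := testL2 (tp n).
have tpb b n := partL2 b (tp n).
have tK n : test_fun Om (cut2 e \o phi n) by exact: test_fun_cut2.
have tG n : test_fun Om (cut3 e \o phi n) by exact: test_fun_cut3.
have dphi n x : differentiable (phi n) x.
  by apply: smooth_differentiable; case: (tp n).
pose G' t := (3 * t ^+ 2 + e * t ^+ 4) * cutinv e t ^+ 2.
have dG n b x : partial b (cut3 e \o phi n) x = G' (phi n x) * partial b (phi n) x.
  exact: (partial_comp _ (dphi n x) (is_derive_cut3 e0 _)).
have dK n b x : partial b (cut2 e \o phi n) x =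
    2 * phi n x * cutinv e (phi n x) ^+ 2 * partial b (phi n) x.
  exact: (partial_comp _ (dphi n x) (is_derive_cut2 e0 _)).
have dG2 n := partL2 false (tG n); have dG2' n := partL2 true (tG n).
have Kv2 := torsion_cut2_L2 e0.
have cK : (fun n => I (fun x => (cut2 e (phi n x)) ^+ 2)) @ \oo -->
    I (fun x => cut2 e (v x) ^+ 2).
  have cc : (fun n => I (fun x => (cut2 e (phi n x) - cut2 e (v x)) ^+ 2)) @ \oo --> 0.
    have c0' : (fun n => e^-1 * I (fun x => (phi n x - v x) ^+ 2)) @ \oo --> 0.
      by rewrite -(mulr0 e^-1); exact: (cvgM (cvg_cst _) c0).
    apply: (squeeze_cvgr _ (cvg_cst 0) c0'); near=> n.
    rewrite Rintegral_ge0/=; last by move=> x _; exact: sqr_ge0.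
    apply: (Rintegral_le_scale mOm (L2B mOm (testL2 (tK n)) Kv2)).
      exact: (L2B mOm (tp2 n) v2).
    by move=> x; exact: cut2_lip.
  exact: (cvg_L2X mOm (fun n => testL2 (tK n)) Kv2 cc).
have bE : exists C, forall n, I (fun x => dx (phi n) x ^+ 2 + dy (phi n) x ^+ 2) <= C.
  have bnd : cvgn (fun n => I (fun x => dx (phi n) x ^+ 2 + dy (phi n) x ^+ 2)).
    by apply/cvg_ex; exists (I v).
  have [C [_ HC]] := cvg_seq_bounded bnd.
  by exists (C + 1) => n; apply: le_trans (ler_norm _) (HC _ _ n _) => //; rewrite ltrDl.
have [C HC] := bE.
have bG b n : I (fun x => partial b (cut3 e \o phi n) x ^+ 2) <= (3 / e) ^+ 2 * C.
  have [h1 h2] := Rintegral_sqD_ge mOm (tpb false n) (tpb true n).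
  have hC : I (fun x => partial b (phi n) x ^+ 2) <= C.
    by apply: le_trans (HC n); case: (b); [exact: h2|exact: h1].
  apply: le_trans (ler_wpM2l (sqr_ge0 _) hC).
  have dGb : partial b (cut3 e \o phi n) = fun x => G' (phi n x) * partial b (phi n) x.
    by apply/funext => x; exact: dG.
  have := partL2 b (tG n); rewrite dGb => GL.
  apply: (Rintegral_sqM_le mOm (tpb b n) GL) => x.
  exact: cut3_derive_bound.
have err1 : (fun n => I (fun x => (dx (phi n) x - g1 x) * dx (cut3 e \o phi n) x)) @ \oo --> 0.
  exact: (cvg_L2M0 mOm (fun n => L2B mOm (tpb false n) g12) dG2 c1 (bG false)).
have err2 : (fun n => I (fun x => (dy (phi n) x - g2 x) * dy (cut3 e \o phi n) x)) @ \oo --> 0.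
  exact: (cvg_L2M0 mOm (fun n => L2B mOm (tpb true n) g22) dG2' c2 (bG true)).
have main n : lam / 2 * I (fun x => cut2 e (phi n x) ^+ 2) <=
    8 / (9 * lam) * I (fun x => phi n x ^+ 2) +
    4 / 3 * (I (fun x => (dx (phi n) x - g1 x) * dx (cut3 e \o phi n) x) +
             I (fun x => (dy (phi n) x - g2 x) * dy (cut3 e \o phi n) x)).
  apply: (truncated_moment_le mOm finOm lam1 (tp2 n) (testL2 (tK n)) (testL2 (tG n))
    (tpb false n) (tpb true n) (partL2 false (tK n)) (partL2 true (tK n)) (dG2 n)
    (dG2' n) g12 g22 (ray (tK n)) (torsion_weak (tG n))) => x; last exact: cut3E.
  rewrite !dK !dG; have := cut2_derive_sq_le e0 (phi n x); rewrite -/(G' _).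
  move: (2 * _ * _) (G' _) (dx _ x) (dy _ x) => k g p q h.
  have := ler_wpM2r (sqr_ge0 p) h; have := ler_wpM2r (sqr_ge0 q) h.
  by rewrite !exprMn; lra.
have L : (fun n => 8 / (9 * lam) * I (fun x => phi n x ^+ 2) +
    4 / 3 * (I (fun x => (dx (phi n) x - g1 x) * dx (cut3 e \o phi n) x) +
             I (fun x => (dy (phi n) x - g2 x) * dy (cut3 e \o phi n) x))) @ \oo -->
    8 / (9 * lam) * I (fun x => v x ^+ 2) + 4 / 3 * (0 + 0).
  apply: (cvgD (cvgM (cvg_cst _) a)).
  exact: (cvgM (cvg_cst _) (cvgD err1 err2)).
have K : (fun n => lam / 2 * I (fun x => cut2 e (phi n x) ^+ 2)) @ \oo -->
   lam / 2 * I (fun x => cut2 e (v x) ^+ 2).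
  exact: (cvgM (cvg_cst _) cK).
have := ler_cvg_to K L (nearW _ main).
rewrite addr0 mulr0 addr0 => h.
have -> : lam ^+ 2 * I (fun x => cut2 e (v x) ^+ 2) =
   (2 * lam) * (lam / 2 * I (fun x => cut2 e (v x) ^+ 2)) by field.
have -> : 16 / 9 * I (fun x => v x ^+ 2) =
   (2 * lam) * (8 / (9 * lam) * I (fun x => v x ^+ 2)) by field; rewrite gt_eqF.
by apply: ler_wpM2l; [rewrite mulr_ge0|exact: h].
Unshelve. all: by end_near. Qed.

(** Monotone convergence: as e = 1 / (n + 1) decreases, the squares of [cut2 e] increase to the
    fourth power, while the bound does not depend on e. The extended-real form also delivers
    integrability of v^4. *)
Lemma torsion_fourth_moment : 0 < lam ->
  (\int[mu]_(x in Om) (v x ^+ 4)%:E <= (16 / (9 * lam ^+ 2) * I (fun x => v x ^+ 2))%:E)%E.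
Proof.
move=> lam1.
pose e n : R := n.+1%:R^-1.
have e0 n : 0 < e n by rewrite invr_gt0.
pose g n x : \bar R := (cut2 (e n) (v x) ^+ 2)%:E.
have glim x : g n x @[n --> \oo] --> (v x ^+ 4)%:E.
  apply: cvg_EFin; first by apply: nearW => n.
  have -> : v x ^+ 4 = (v x ^+ 2 * (1 + 0 * v x ^+ 2)^-1) ^+ 2.
    by rewrite mul0r addr0 invr1 mulr1 -exprM.
  have h : (fun n => v x ^+ 2 * (1 + e n * v x ^+ 2)^-1) @ \oo -->
      v x ^+ 2 * (1 + 0 * v x ^+ 2)^-1.
    apply: (cvgM (cvg_cst _)); apply: cvgV; first by rewrite mul0r addr0 oner_neq0.
    by apply: (cvgD (cvg_cst _)); apply: (cvgM _ (cvg_cst _)); exact: cvg_harmonic.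
  exact: (cvgM h h).
have mg n : measurable_fun Om (g n).
  apply/measurable_EFinP; apply: measurable_funX.
  by case: (torsion_cut2_L2 (e0 n)).
have nd x : nondecreasing_seq (g^~ x).
  move=> n m nm; rewrite /g lee_fin lerXn2r ?nnegrE ?cut2_ge0//.
  rewrite /cut2 ler_wpM2l ?sqr_ge0// /cutinv.
  have p k : 0 < 1 + e k * v x ^+ 2.
    by rewrite ltr_pwDl// mulr_ge0 ?sqr_ge0// ltW.
  rewrite lef_pV2 ?posrE// lerD2l ler_wpM2r ?sqr_ge0//.
  by rewrite /e lef_pV2 ?posrE// ler_nat.
have := @cvg_monotone_convergence _ _ _ mu Om mOm g mg
  (fun n x _ => ltac:(by rewrite lee_fin sqr_ge0)) (fun x _ => nd x).
have -> : (fun x => limn (g^~ x)) = fun x => (v x ^+ 4)%:E.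
  by apply/funext => x; exact: cvg_lim (glim x).
move=> c; apply: (cvge_to_le c); near=> n.
rewrite (L2_integralE mOm (torsion_cut2_L2 (e0 n))) lee_fin.
have -> : 16 / (9 * lam ^+ 2) * I (fun x => v x ^+ 2) =
    (16 / 9 * I (fun x => v x ^+ 2)) / lam ^+ 2 by field; rewrite gt_eqF.
by rewrite ler_pdivlMr ?exprn_gt0// mulrC; exact: torsion_cut.
Unshelve. all: by end_near. Qed.

End torsion_estimates.

(** * Chords *)

Section line_inequality.
Variable R : realType.
Local Notation leb := (@lebesgue_measure R).
Local Notation dm := (measurableTypeR R).

(** The function u^2 - 2 u = (u - 1)^2 - 1 vanishes with u, so the derivative of its product with q
    integrates to 0. The slope k of q times the constant -1 is what produces k |S|; centring q at
    the midpoint keeps |q| <= k L / 2. *)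
Lemma slice_inequality (S : set R) (u du : R -> R) (k M L a : R) :
  measurable (S : set dm) -> (forall x, S x -> a <= x <= a + L) ->
  (forall x : R, is_derive x 1 u (du x)) -> continuous du ->
  (forall x, ~ S x -> u x = 0) -> (forall x, ~ S x -> du x = 0) ->
  0 <= k -> 0 <= L -> M = k + k ^+ 2 * L ^+ 2 / 4 ->
  (\int[leb]_(x in S) k%:E <= \int[leb]_(x in S) (du x ^+ 2 + M * (u x - 1) ^+ 2)%:E)%E.
Proof.
move=> mS SaL du1 cdu u0 du0 k0 L0 ME.
(* The margin of 1 on each side puts both endpoints outside S, where F vanishes, and keeps the
   interval nondegenerate when L = 0. *)
pose B : set R := `[a - 1, a + L + 1]%classic.
have mB : measurable (B : set dm) by exact: measurable_itv.
have SB : S `<=` B.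
  by move=> x /SaL/andP[x1 x2]; rewrite /B/= in_itv/=; apply/andP; split; lra.
have muB : (leb B < +oo)%E.
  by rewrite /B lebesgue_measure_itv/=; case: ifP => _; rewrite ?ltry// -EFinB ltry.
have cu : continuous u.
  move=> x; apply: differentiable_continuous; apply/derivable1_diffP.
  by case: (du1 x).
pose m := a + L / 2.
pose q x := k * (x - m).
pose F x := q x * (u x ^+ 2 - 2 * u x).
pose dF x := k * (u x ^+ 2 - 2 * u x) + q x * (2 * u x * du x - 2 * du x).
have dFE (x : R) : is_derive x 1 F (dF x).
  have d1 := is_derive1M (is_derive1_cst k x) (is_derive1D (is_derive1_id x) (is_derive1_cst (- m) x)).
  have d2 := is_derive1D (is_derive1X 2 (du1 x)) (is_derive1M (is_derive1_cst (- 2) x) (du1 x)).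
  have := is_derive1M d1 d2; rewrite (_ : (fun t => _) = F); last first.
    by apply/funext => t; rewrite /F /q; ring.
  by move=> /is_derive_eq; apply; rewrite /dF /q /=; ring.
have cdF : continuous dF.
  move=> x; rewrite /dF /q.
  have cux := cu x; have cdux := cdu x.
  have c1 : {for x, continuous (fun x => u x ^+ 2 - 2 * u x)}.
    by apply: cvgB; [exact: (cvgM cux cux)|exact: (cvgM (cvg_cst _) cux)].
  have c2 : {for x, continuous (fun x => 2 * u x * du x - 2 * du x)}.
    apply: cvgB; last exact: (cvgM (cvg_cst _) cdux).
    exact: (cvgM (cvgM (cvg_cst _) cux) cdux).
  apply: cvgD; first exact: (cvgM (cvg_cst _) c1).
  apply: (cvgM _ c2); apply: (cvgM (cvg_cst _)).
  exact: (cvgB cvg_id (cvg_cst _)).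
have ends x : (x < a) || (a + L < x) -> F x = 0.
  move=> xa; rewrite /F u0; first by ring.
  by move=> /SaL; lra.
have FTC : (\int[leb]_(x in B) (dF x)%:E = 0)%E.
  rewrite /B (@continuous_FTC2 R dF F)//.
  - by rewrite !ends ?subee//; apply/orP; [left|right]; lra.
  - by lra.
  - exact: continuous_subspaceT.
  - split => [x _||]; first by case: (dFE x).
    + apply: cvg_at_right_filter; apply: differentiable_continuous.
      by apply/derivable1_diffP; case: (dFE (a - 1)).
    + apply: cvg_at_left_filter; apply: differentiable_continuous.
      by apply/derivable1_diffP; case: (dFE (a + L + 1)).
  - by move=> x _; rewrite derive1E; case: (dFE x).
pose h x := du x ^+ 2 + M * (u x - 1) ^+ 2.
have M0 : 0 <= M.
  by rewrite ME addr_ge0// divr_ge0// mulr_ge0 ?sqr_ge0.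
have ch : continuous h.
  move=> x; have cux := cu x; have cdux := cdu x; apply: cvgD.
    exact: (cvgM cdux cdux).
  apply: (cvgM (cvg_cst _)).
  by apply: cvgM; exact: (cvgB cux (cvg_cst _)).
have mh : measurable_fun setT (h : dm -> dm) by exact: continuous_measurable_fun.
have mdF : measurable_fun setT (dF : dm -> dm) by exact: continuous_measurable_fun.
have idF : leb.-integrable B (EFin \o dF).
  apply: continuous_compact_integrable; first exact: segment_compact.
  exact: continuous_subspaceT.
(* On S the difference of the two sides is (du + q (1 - u))^2 + (k^2 L^2 / 4 - q^2) (1 - u)^2; off S
   both sides are 0. *)
have key x : k * \1_S x + dF x <= h x * \1_S x.
  rewrite indicE; case: (boolP (x \in S)) => [/set_mem /SaL/andP[x1 x2]|/negP xS].
    rewrite !mulr1 /h /dF ME.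
    have qL : q x ^+ 2 <= k ^+ 2 * L ^+ 2 / 4.
      rewrite /q exprMn -mulrA ler_wpM2l ?sqr_ge0// /m; nra.
    have := sqr_ge0 (du x + q x * (1 - u x)).
    have := mulr_ge0 (sqr_ge0 (1 - u x)) (ltac:(rewrite subr_ge0; exact: qL)
       : 0 <= k ^+ 2 * L ^+ 2 / 4 - q x ^+ 2).
    nra.
  have nS : ~ S x by move=> Sx; apply: xS; exact: mem_set.
  by rewrite /dF u0// du0// expr0n/= !mulr0 subrr !mulr0 addr0.
rewrite -/h.
rewrite [leLHS](_ : _ = \int[leb]_(x in B) (k * \1_S x + dF x)%:E)%E; last first.
  have iS : leb.-integrable B (EFin \o (fun x => k * \1_S x)).
    apply: integrable_funZ => //; apply: (@integrable_bounded _ _ _ _ _ _ _ _ 1) => //.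
    by move=> x _; rewrite indicE; case: (_ \in _); rewrite ?normr1 ?normr0.
  have := @integralD _ _ _ leb B mB (EFin \o (fun x => k * \1_S x)) (EFin \o dF) iS idF.
  rewrite /= FTC adde0 => ->.
  rewrite [LHS]integral_mkcond [RHS]integral_mkcond; apply: eq_integral => x _ /=.
  rewrite !patchE indicE; case: ifPn => xS.
    by rewrite ifT ?mulr1//; apply/mem_set/SB/set_mem.
  by rewrite mulr0; case: ifP.
rewrite [leRHS](_ : _ = \int[leb]_(x in B) (h x * \1_S x)%:E)%E; last first.
  rewrite [LHS]integral_mkcond [RHS]integral_mkcond; apply: eq_integral => x _ /=.
  rewrite !patchE indicE; case: ifPn => xS.
    by rewrite ifT ?mulr1//; apply/mem_set/SB/set_mem.
  by rewrite mulr0; case: ifP.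
apply: le_integral => //.
- apply: integrable_funD => //; apply: integrable_funZ => //.
  apply: (@integrable_bounded _ _ _ _ _ _ _ _ 1) => //.
  by move=> x _; rewrite indicE; case: (_ \in _); rewrite ?normr1 ?normr0.
- have ih : leb.-integrable B (EFin \o h).
    apply: continuous_compact_integrable; first exact: segment_compact.
    exact: continuous_subspaceT.
  apply: le_integrable ih => //.
    apply/measurable_EFinP; apply: measurable_funM => //.
    by apply: measurable_funTS.
  move=> x _ /=; rewrite lee_fin normrM indicE.
  by case: (_ \in _); rewrite ?normr1 ?normr0 ?mulr1 ?mulr0.
- by move=> x _; rewrite lee_fin.
Qed.

End line_inequality.

Section plane_slices.
Variable R : realType.
Local Notation leb := (@lebesgue_measure R).
Local Notation dm := (measurableTypeR R).

Lemma is_derive_slice (phi : R * R -> R) (x y : R) : differentiable phi (x, y) ->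
  is_derive x 1 (fun t => phi (t, y)) (partial false phi (x, y)).
Proof.
move=> dphi.
have E : (fun h : R => h^-1 *: (phi (h *: 1 + x, y) - phi (x, y))) =
         (fun h : R => h^-1 *: (phi (h *: dir R false + (x, y)) - phi (x, y))).
  apply/funext => h; congr (_ *: (phi _ - _)).
  by apply/pair_equal_spec; split => /=; rewrite ?scaler0 ?add0r.
have d : derivable phi (x, y) (dir R false) by exact: diff_derivable.
by split; rewrite /derivable /derive /partial /= E.
Qed.

Lemma continuous_slice (f : R * R -> R) (y : R) : continuous f ->
  continuous (fun t => f (t, y)).
Proof.
move=> cf t; apply: (@continuous_comp _ _ _ (fun t => (t, y)) f); last exact: cf.
move=> A /nbhs_ballP[e /= e0 eA]; apply/nbhs_ballP; exists e => //= s ts.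
by apply: eA; split => //; exact: ballxx.
Qed.

Lemma open_ysection (Om : set (R * R)) (y : R) : open Om -> open [set x | Om (x, y)].
Proof.
move=> oOm; rewrite openE => x Ox.
have /nbhs_ballP[e /= e0 eO] : nbhs (x, y) Om by exact: open_nbhs_nbhs.
apply/nbhs_ballP; exists e => //= t xt; apply: eO; split => //.
exact: ballxx.
Qed.

Lemma horizontal_slice_inequality (Om : set (R * R)) (L k M : R) phi :
  open Om -> (leb2 R Om < +oo)%E -> 0 <= k -> 0 <= L ->
  (forall x x' y, Om (x, y) -> Om (x', y) -> x - x' <= L) ->
  M = k + k ^+ 2 * L ^+ 2 / 4 -> test_fun Om phi ->
  k * fine (leb2 R Om) <=
  \int[leb2 R]_(z in Om) (partial false phi z ^+ 2 + M * (phi z - 1) ^+ 2).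
Proof.
move=> oOm finOm k0 L0 slice ME tp.
have mOm := open_measurable_plane oOm.
have M0 : 0 <= M by rewrite ME addr_ge0// divr_ge0// mulr_ge0 ?sqr_ge0.
pose f z := partial false phi z ^+ 2 + M * (phi z - 1) ^+ 2.
have f0 z : 0 <= f z by rewrite addr_ge0 ?sqr_ge0// mulr_ge0 ?sqr_ge0.
have tpx := test_fun_partial false tp.
have cphi : continuous phi by apply: smooth_continuous; case: tp.
have cpx : continuous (partial false phi) by apply: smooth_continuous; case: tpx.
have mf : measurable_fun (setT : set (dm * dm)) f.
  apply: continuous_measurable_plane => z.
  have c1 := cphi z; have c2 := cpx z; apply: cvgD; first exact: (cvgM c2 c2).
  apply: (cvgM (cvg_cst _)).
  by apply: cvgM; exact: (cvgB c1 (cvg_cst _)).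
have mfO : measurable_fun (setT : set (dm * dm)) ((EFin \o f) \_ Om).
  apply/(measurable_restrictT _ _).1 => //.
  by apply/measurable_EFinP; exact: measurable_funTS.
have mkO : measurable_fun (setT : set (dm * dm)) ((EFin \o cst k) \_ Om).
  by apply/(measurable_restrictT _ _).1 => //; exact: (measurable_cst k%:E).
have fin : leb2 R Om \is a fin_num by rewrite ge0_fin_numE.
(* An infinite integral would be sent to 0 by [fine], so finiteness must be known before returning
   to real integrals. *)
have ifin : (\int[leb2 R]_(z in Om) (f z)%:E)%E \is a fin_num.
  have [C C0 HC] := test_fun_bounded tp; have [C' C'0 HC'] := test_fun_bounded tpx.
  apply: integrable_fin_num => //.
  apply: (@integrable_bounded _ _ _ (leb2 R) Om mOm finOm f (C' ^+ 2 + M * (C + 1) ^+ 2)) => //.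
    exact: measurable_funTS.
  move=> z _; rewrite ger0_norm//; apply: lerD.
    by rewrite -(real_normK (num_real _)) lerXn2r ?nnegrE.
  rewrite ler_wpM2l// -(real_normK (num_real (phi z - 1))) lerXn2r ?nnegrE ?addr_ge0//.
  by apply: le_trans (ler_normB _ _) _; rewrite normr1 lerD2r.
suff : (\int[leb2 R]_(z in Om) k%:E <= \int[leb2 R]_(z in Om) (f z)%:E)%E.
  rewrite integral_cst// => h; rewrite -lee_fin EFinM fineK//.
  by apply: le_trans h _; rewrite fineK.
rewrite [leLHS]integral_mkcond [leRHS]integral_mkcond.
rewrite (fubini_tonelli2 _ mkO); last by move=> z; rewrite patchE; case: ifP.
rewrite (fubini_tonelli2 _ mfO); last first.
  by move=> z; rewrite patchE; case: ifP => //; rewrite lee_fin.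
apply: ge0_le_integral => //.
- move=> y _; apply: integral_ge0 => x _; rewrite patchE; case: ifP => //.
- by apply: measurable_fun_fubini_tonelli_G => // z; rewrite patchE; case: ifP.
- by apply: measurable_fun_fubini_tonelli_G => // z; rewrite patchE; case: ifP => //; rewrite lee_fin.
move=> y _; pose S := [set x | Om (x, y)].
have mS : measurable (S : set dm) by apply: open_measurable; exact: open_ysection.
have E (g : R * R -> R) : fubini_G leb ((EFin \o g) \_ Om) y =
    (\int[leb]_(x in S) (g (x, y))%:E)%E.
  rewrite /fubini_G [RHS]integral_mkcond; apply: eq_integral => x _.
  by rewrite !patchE; congr (if _ then _ else _).
apply: (@le_trans _ _ (\int[leb]_(x in S) (cst k (x, y))%:E)%E).
  by rewrite -(E (cst k)); exact: lexx.
apply: (@le_trans _ _ (\int[leb]_(x in S) (f (x, y))%:E)%E); last first.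
  by rewrite -(E f); exact: lexx.
have [[x0 Sx0]|S0] := pselect (exists x, S x); last first.
  have -> : S = set0 by apply/seteqP; split => // x Sx; apply: S0; exists x.
  by rewrite !integral_set0.
(* A nonempty section lies in the interval from inf S to inf S + L; the empty one was set aside
   because its infimum carries no information. *)
have lbS : has_inf S.
  by split; [exists x0|exists (x0 - L) => x Sx; have := slice x0 x y Sx0 Sx; lra].
apply: (@slice_inequality R S (fun t => phi (t, y)) (fun t => partial false phi (t, y))
  k M L (inf S)) => //.
- move=> x Sx; apply/andP; split; first by apply: ge_inf => //; case: lbS.
  rewrite -lerBlDr; apply: lb_le_inf; first by exists x0.
  by move=> z Sz; have := slice x z y Sx Sz; lra.
- by move=> x; apply: is_derive_slice; apply: smooth_differentiable; case: tp.
- exact: continuous_slice.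
- by move=> x Sx; exact: test_fun_out tp Sx.
- by move=> x Sx; exact: test_fun_out tpx Sx.
Qed.

End plane_slices.

(** * A test function on a parallelogram *)

Section profile.
Variables (R : realType) (a : R).
Hypothesis a0 : 0 < a.
Local Notation leb := (@lebesgue_measure R).
Local Notation E := (flat a).

Definition parab (r : R) : R := r * (1 - r).

(* With [p = parab r] this is [p * exp (- a / p)] on ]0, 1[, extended by 0. *)
Definition profile (r : R) : R := parab r * E 0 (parab r).
Definition dprofile (r : R) : R :=
  (1 - 2 * r) * (E 0 (parab r) + a * E 1 (parab r)).

Lemma is_derive_parab (r : R) : is_derive r 1 parab (1 - 2 * r).
Proof.
have := is_derive1M (is_derive1_id r)
  (is_derive1D (is_derive1_cst 1 r) (is_derive1M (is_derive1_cst (-1) r) (is_derive1_id r))).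
rewrite (_ : (fun t => _) = parab); last by apply/funext => t; rewrite /parab; ring.
by move=> /is_derive_eq; apply; ring.
Qed.

Lemma flatS k p : p * E k.+1 p = E k p.
Proof.
rewrite /flat; case: ifPn => [p0|]; last by rewrite mulr0.
by rewrite exprS invfM; field; rewrite ?gt_eqF ?exprn_gt0.
Qed.

Lemma is_derive_profile (r : R) : is_derive r 1 profile (dprofile r).
Proof.
have dE := is_derive1_comp (is_derive_flat a0 0 (parab r)) (is_derive_parab r).
have := is_derive1M (is_derive_parab r) dE.
move=> /is_derive_eq; apply; rewrite /dprofile /= -[E 1 _]flatS; ring.
Qed.

Lemma flat_continuous k : continuous (E k).
Proof.
move=> p; apply: differentiable_continuous; apply/derivable1_diffP.
by case: (is_derive_flat a0 k p).
Qed.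

Lemma parab_continuous : continuous parab.
Proof.
move=> p; apply: differentiable_continuous; apply/derivable1_diffP.
by case: (is_derive_parab p).
Qed.

Lemma profile_continuous : continuous profile.
Proof.
move=> p; apply: differentiable_continuous; apply/derivable1_diffP.
by case: (is_derive_profile p).
Qed.

Lemma dprofile_continuous : continuous dprofile.
Proof.
move=> r; have cE k : {for r, continuous (fun r => E k (parab r))}.
  by apply: continuous_comp; [exact: parab_continuous|exact: flat_continuous].
apply: cvgM; last exact: (cvgD (cE 0) (cvgM (cvg_cst _) (cE 1))).
exact: (cvgB (cvg_cst _) (cvgM (cvg_cst _) cvg_id)).
Qed.

Lemma parab_gt0 r : (0 < parab r) = (0 < r < 1).
Proof.
rewrite /parab; apply/idP/idP => [h|/andP[r0 r1]]; last by rewrite mulr_gt0// subr_gt0.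
by apply/andP; split; nra.
Qed.

Lemma flat_parab_out k r : ~~ (0 < r < 1) -> E k (parab r) = 0.
Proof. by rewrite -parab_gt0 /flat => /negbTE ->. Qed.

Lemma profile_out r : ~~ (0 < r < 1) -> profile r = 0.
Proof. by move=> r01; rewrite /profile flat_parab_out// mulr0. Qed.

Lemma dprofile_out r : ~~ (0 < r < 1) -> dprofile r = 0.
Proof. by move=> r01; rewrite /dprofile !flat_parab_out// mulr0 addr0 mulr0. Qed.

(** The smoothing multiplies the slope of the parabola by (1 + z) exp (- z) with z = a / p, a factor
    between 0 and 1. *)
Lemma dprofile_sq_le r : dprofile r ^+ 2 <= (1 - 2 * r) ^+ 2.
Proof.
rewrite /dprofile exprMn -[leRHS]mulr1 ler_wpM2l ?sqr_ge0//.
rewrite /flat; case: ifPn => [p0|_]; last by rewrite mulr0 addr0 expr0n ler01.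
set p := parab r in p0 *.
have z0 : 0 < a / p by rewrite divr_gt0.
have -> : p ^- 0 * expR (- a / p) + a * (p ^- 1 * expR (- a / p)) =
    (1 + a / p) * expR (- (a / p)).
  by rewrite mulNr expr0 expr1; field; rewrite gt_eqF.
have h : (1 + a / p) * expR (- (a / p)) <= 1.
  by rewrite expRN ler_pdivrMr ?expR_gt0// mul1r expR_ge1Dx.
by rewrite exprn_ile1// mulr_ge0 ?expR_ge0// addr_ge0// ltW.
Qed.

(** For p >= a, exp (- a / p) >= 1 - a / p gives p exp (- a / p) >= p - a, which is then squared;
    for p < a the left side is not positive. *)
Lemma profile_sq_ge r : 0 <= r <= 1 -> parab r ^+ 2 - 2 * a * parab r <= profile r ^+ 2.
Proof.
move=> /andP[r0 r1]; have p0 : 0 <= parab r by rewrite mulr_ge0// subr_ge0.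
have [pa|pa] := ltP (parab r) a.
  by apply: le_trans (sqr_ge0 _); nra.
have p1 : 0 < parab r by exact: lt_le_trans pa.
have h : parab r - a <= profile r.
  rewrite /profile /flat p1 expr0 invr1 mul1r.
  have := expR_ge1Dx (- a / parab r).
  move=> /(ler_wpM2l p0); apply: le_trans.
  by rewrite mulrDr mulr1 mulrCA mulfV ?gt_eqF// mulr1.
nra.
Qed.

Definition profile_mass : R := \int[leb]_(r in `[0, 1]) profile r ^+ 2.
Definition profile_energy : R := \int[leb]_(r in `[0, 1]) dprofile r ^+ 2.

Let itv_integrable (f : R -> R) : continuous f -> leb.-integrable `[0, 1] (EFin \o f).
Proof.
move=> cf; apply: continuous_compact_integrable; first exact: segment_compact.
exact: continuous_subspaceT.
Qed.

Let Rintegral_derive (f F : R -> R) : (forall r : R, is_derive r 1 F (f r)) ->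
  continuous f -> \int[leb]_(r in `[0, 1]) f r = F 1 - F 0.
Proof.
move=> dF cf; have cF (r : R) : {for r, continuous F}.
  by apply: differentiable_continuous; apply/derivable1_diffP; case: (dF r).
rewrite /Rintegral (@continuous_FTC2 R f F)//.
- exact: continuous_subspaceT.
- split => [x _||]; first by case: (dF x).
  + by apply: cvg_at_right_filter; exact: cF.
  + by apply: cvg_at_left_filter; exact: cF.
- by move=> x _; rewrite derive1E; case: (dF x).
Qed.

Let is_derive_monom (c : R) n (r : R) :
  is_derive r 1 (fun t : R => c * t ^+ n) (c * (n%:R * r ^+ n.-1)).
Proof.
apply: is_derive_eq (is_derive1M (is_derive1_cst c r) (is_derive1X n (is_derive1_id r))) _.
by ring.
Qed.

Let continuous_sq (f : R -> R) : continuous f -> continuous (fun r => f r ^+ 2).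
Proof. by move=> cf r; have cr := cf r; exact: (cvgM cr cr). Qed.

Lemma profile_energy_le : profile_energy <= 1 / 3.
Proof.
pose f (r : R) : R := (1 - 2 * r) ^+ 2.
pose F (r : R) : R := 1 * r ^+ 1 + (- 2 * r ^+ 2 + 4 / 3 * r ^+ 3).
have dF (r : R) : is_derive r 1 F (f r).
  apply: is_derive_eq (is_derive1D (is_derive_monom 1 1 r)
    (is_derive1D (is_derive_monom (- 2) 2 r) (is_derive_monom (4 / 3) 3 r))) _.
  by rewrite /f /=; field.
have cf : continuous f.
  apply: continuous_sq => r.
  exact: (cvgB (cvg_cst _) (cvgM (cvg_cst _) cvg_id)).
have -> : 1 / 3 = \int[leb]_(r in `[0, 1]) f r.
  by rewrite (Rintegral_derive dF cf) /F; field.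
apply: le_Rintegral => //.
- by apply: itv_integrable; apply: continuous_sq; exact: dprofile_continuous.
- exact: itv_integrable.
- by move=> r _; exact: dprofile_sq_le.
Qed.

(** The integrals over [0, 1] of p^2 and p are 1/30 and 1/6. Together with the energy bound 1/3, the
    quotient is close to 10 for small a. *)
Lemma profile_mass_ge : 1 / 30 - a / 3 <= profile_mass.
Proof.
pose f (r : R) : R := parab r ^+ 2 - 2 * a * parab r.
pose F (r : R) : R := - a * r ^+ 2 + ((1 + 2 * a) / 3 * r ^+ 3 +
  (- (1 / 2) * r ^+ 4 + 1 / 5 * r ^+ 5)).
have dF (r : R) : is_derive r 1 F (f r).
  apply: is_derive_eq (is_derive1D (is_derive_monom (- a) 2 r)
    (is_derive1D (is_derive_monom ((1 + 2 * a) / 3) 3 r)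
    (is_derive1D (is_derive_monom (- (1 / 2)) 4 r) (is_derive_monom (1 / 5) 5 r)))) _.
  by rewrite /f /parab /=; field.
have cp := parab_continuous.
have cf : continuous f.
  move=> r; have c1 := continuous_sq cp (x := r); have c2 := cp r.
  exact: (cvgB c1 (cvgM (cvg_cst _) c2)).
have -> : 1 / 30 - a / 3 = \int[leb]_(r in `[0, 1]) f r.
  by rewrite (Rintegral_derive dF cf) /F; field.
apply: le_Rintegral => //.
- exact: itv_integrable.
- by apply: itv_integrable; apply: continuous_sq; exact: profile_continuous.
- by move=> r; rewrite /= in_itv/=; exact: profile_sq_ge.
Qed.

Lemma profile_energy_ge0 : 0 <= profile_energy.
Proof. by apply: Rintegral_ge0 => r _; exact: sqr_ge0. Qed.

(** The integral over the line reduces to [c, c + l], where the profile lives, and then to [0, 1] by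
    substitution. *)
Lemma integral_profile (al be c l : R) : 0 < l ->
  (\int[leb]_x ((al * dprofile ((x - c) / l) + be * profile ((x - c) / l)) ^+ 2)%:E =
   (l * (al ^+ 2 * profile_energy + be ^+ 2 * profile_mass))%:E)%E.
Proof.
move=> l0.
pose G r := (al * dprofile r + be * profile r) ^+ 2.
have cp := profile_continuous; have cdp := dprofile_continuous.
have cG : continuous G.
  move=> r; have c1 := cp r; have c2 := cdp r.
  have c3 : {for r, continuous (fun r => al * dprofile r + be * profile r)}.
    exact: (cvgD (cvgM (cvg_cst _) c2) (cvgM (cvg_cst _) c1)).
  exact: (cvgM c3 c3).
have E1 : (\int[leb]_(r in `[0%R, 1%R]) (G r)%:E =
    (al ^+ 2 * profile_energy + be ^+ 2 * profile_mass)%:E)%E.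
  have i1 : leb.-integrable `[0, 1] (EFin \o (fun r => dprofile r ^+ 2)).
    by apply: itv_integrable; exact: continuous_sq.
  have i2 : leb.-integrable `[0, 1] (EFin \o (fun r => profile r ^+ 2)).
    by apply: itv_integrable; exact: continuous_sq.
  have i3 : leb.-integrable `[0, 1] (EFin \o (fun r => 2 * profile r * dprofile r)).
    apply: itv_integrable => r; have c1 := cp r; have c2 := cdp r.
    exact: (cvgM (cvgM (cvg_cst _) c1) c2).
  (* The mixed term is the derivative of [profile]^2, which vanishes at both ends; this is why the
     shear will contribute no cross term. *)
  have z : \int[leb]_(r in `[0, 1]) (2 * profile r * dprofile r) = 0.
    have dsq (r : R) : is_derive r 1 (fun r => profile r ^+ 2) (2 * profile r * dprofile r).
      by apply: is_derive_eq (is_derive1X 2 (is_derive_profile r)) _; rewrite /=; ring.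
    rewrite (Rintegral_derive dsq); first by rewrite !profile_out ?ltxx ?andbF// subrr.
    move=> r; have c1 := cp r; have c2 := cdp r.
    exact: (cvgM (cvgM (cvg_cst _) c1) c2).
  transitivity (\int[leb]_(r in `[0, 1]) G r)%R%:E.
    by rewrite fineK//; apply: integrable_fin_num => //; exact: itv_integrable.
  congr EFin.
  rewrite (@eq_Rintegral _ _ _ leb _ (fun r => al ^+ 2 * dprofile r ^+ 2 +
    (be ^+ 2 * profile r ^+ 2 + al * be * (2 * profile r * dprofile r)))); last first.
    by move=> r _; rewrite /G; ring.
  have m01 : measurable (`[0, 1]%classic : set (measurableTypeR R)) by exact: measurable_itv.
  have j1 := integrable_funZ m01 (al ^+ 2) i1.
  have j2 := integrable_funZ m01 (be ^+ 2) i2.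
  have j3 := integrable_funZ m01 (al * be) i3.
  rewrite (RintegralD m01 j1 (integrable_funD m01 j2 j3)) (RintegralD m01 j2 j3).
  by rewrite (RintegralZl _ m01 i1) (RintegralZl _ m01 i2) (RintegralZl _ m01 i3) z mulr0 addr0.
pose F (x : R) : R := (x - c) / l.
have dF (x : R) : is_derive x 1 F l^-1.
  have := is_derive1M (is_derive1D (is_derive1_id x) (is_derive1_cst (- c) x)) (is_derive1_cst l^-1 x).
  by move=> /is_derive_eq; apply; ring.
have F' : derive1 F = fun=> l^-1.
  by apply/funext => x; rewrite derive1E; case: (dF x).
have Fc : F c = 0 by rewrite /F subrr mul0r.
have Fcl : F (c + l) = 1 by rewrite /F addrAC subrr add0r mulfV// gt_eqF.
have cF (x : R) : {for x, continuous F}.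
  by apply: differentiable_continuous; apply/derivable1_diffP; case: (dF x).
have S := @integration_by_substitution_increasing R F G c (c + l).
rewrite Fc Fcl E1 F' in S.
have {}S : ((al ^+ 2 * profile_energy + be ^+ 2 * profile_mass)%:E =
    \int[leb]_(x in `[c, (c + l)%R]) ((G (F x)) * l^-1)%:E)%E.
  apply: S.
  - by rewrite lerDl ltW.
  - by move=> x y _ _ xy; rewrite /F ltr_pM2r ?invr_gt0// ltrD2r.
  - by move=> x _; exact: cvg_cst.
  - exact: is_cvg_cst.
  - exact: is_cvg_cst.
  - split => [x _||]; first by case: (dF x).
    + by apply: cvg_at_right_filter; exact: cF.
    + by apply: cvg_at_left_filter; exact: cF.
  - exact: continuous_subspaceT.
have mGF : measurable_fun setT (fun x : measurableTypeR R => (G (F x) : measurableTypeR R)).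
  apply: continuous_measurable_fun => x.
  by apply: continuous_comp; [exact: cF|exact: cG].
rewrite EFinM S -ge0_integralZl//; last 3 first.
- apply/measurable_EFinP; apply: measurable_funM => //.
  exact: measurable_funTS.
- by move=> x _; rewrite lee_fin mulr_ge0 ?sqr_ge0// invr_ge0 ltW.
- by rewrite lee_fin ltW.
rewrite [RHS]integral_mkcond; apply: eq_integral => x _; rewrite patchE.
case: ifPn => [_|/negP xcl].
  by rewrite -EFinM; congr EFin; rewrite -/(F x) /G; field; rewrite gt_eqF.
have h : ~~ (0 < F x < 1).
  apply/negP => /andP[F0 F1]; apply: xcl; apply/mem_set; rewrite /= in_itv/=.
  move: F0 F1; rewrite /F pmulr_lgt0 ?invr_gt0// ltr_pdivrMr//.
  by move=> h1 h2; apply/andP; split; lra.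
by rewrite profile_out// dprofile_out// !mulr0 addr0 expr0n.
Qed.

End profile.

Section parallelogram.
Variable R : realType.
Local Notation leb := (@lebesgue_measure R).
Local Notation dm := (measurableTypeR R).

Definition affine (c0 c1 c2 : R) (z : R * R) : R := c0 + c1 * z.1 + c2 * z.2.

Lemma differentiable_fst (z : R * R) : differentiable (fun z : R * R => z.1) z.
Proof.
apply: (@linear_differentiable R (R * R)%type R^o fst) => w A /nbhs_ballP[e /= e0 eA].
by apply/nbhs_ballP; exists e => //= t [t1 t2]; apply: eA.
Qed.

Lemma differentiable_snd (z : R * R) : differentiable (fun z : R * R => z.2) z.
Proof.
apply: (@linear_differentiable R (R * R)%type R^o snd) => w A /nbhs_ballP[e /= e0 eA].
by apply/nbhs_ballP; exists e => //= t [t1 t2]; apply: eA.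
Qed.

Lemma partial_fst b (z : R * R) : partial b (fun z : R * R => z.1) z = (dir R b).1.
Proof.
rewrite /partial deriveE; last exact: differentiable_fst.
rewrite (@diff_lin R (R * R)%type R^o fst)// => w A /nbhs_ballP[e /= e0 eA].
by apply/nbhs_ballP; exists e => //= t [t1 t2]; apply: eA.
Qed.

Lemma partial_snd b (z : R * R) : partial b (fun z : R * R => z.2) z = (dir R b).2.
Proof.
rewrite /partial deriveE; last exact: differentiable_snd.
rewrite (@diff_lin R (R * R)%type R^o snd)// => w A /nbhs_ballP[e /= e0 eA].
by apply/nbhs_ballP; exists e => //= t [t1 t2]; apply: eA.
Qed.

Lemma differentiable_affine c0 c1 c2 z : differentiable (affine c0 c1 c2) z.
Proof.
apply: differentiableD; last first.
  by apply: differentiableM; [exact: differentiable_cst|exact: differentiable_snd].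
apply: differentiableD; first exact: differentiable_cst.
by apply: differentiableM; [exact: differentiable_cst|exact: differentiable_fst].
Qed.

Lemma partial_affine b c0 c1 c2 z :
  partial b (affine c0 c1 c2) z = if b then c2 else c1.
Proof.
have d1 : differentiable (fun z : R * R => c1 * z.1) z.
  by apply: differentiableM; [exact: differentiable_cst|exact: differentiable_fst].
have d2 : differentiable (fun z : R * R => c2 * z.2) z.
  by apply: differentiableM; [exact: differentiable_cst|exact: differentiable_snd].
have d0 := differentiable_cst c0 z.
have d01 : differentiable (fun z : R * R => c0 + c1 * z.1) z by exact: differentiableD.
rewrite /affine partialD// partialD// partial_cst !partialZ; last 2 first.
- exact: differentiable_snd.
- exact: differentiable_fst.
by rewrite partial_fst partial_snd; case: b => /=; rewrite ?mulr0 ?mulr1 ?add0r ?addr0.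
Qed.

Variable a : R.
Hypothesis a0 : 0 < a.

Definition bump (s t : R * R -> R) (z : R * R) : R := profile a (s z) * profile a (t z).

(** Differentiating [flat a k] brings in the indices k + 1 and k + 2, so the generators must contain
    every k, together with s and t themselves. *)
Lemma smooth_bump c0 c1 c2 e0 e1 e2 :
  smooth (bump (affine c0 c1 c2) (affine e0 e1 e2)).
Proof.
set s := affine _ _ _; set t := affine _ _ _.
pose B := [set g : R * R -> R | [\/ g = s, g = t,
  exists k, g = flat a k \o (parab (R:=R) \o s) |
  exists k, g = flat a k \o (parab (R:=R) \o t)]].
have Bs : fun_alg B s by apply: fun_alg_base; constructor.
have Bt : fun_alg B t by apply: fun_alg_base; constructor 2.
have Bfs k : fun_alg B (flat a k \o (parab (R:=R) \o s)).
  by apply: fun_alg_base; constructor 3; exists k.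
have Bft k : fun_alg B (flat a k \o (parab (R:=R) \o t)).
  by apply: fun_alg_base; constructor 4; exists k.
have Bp g : fun_alg B g -> fun_alg B (parab (R:=R) \o g).
  move=> Bg; apply: fun_algM => //.
  rewrite (_ : (fun x => _) = fun x => 1 + (-1) * g x); last first.
    by apply/funext => x; rewrite mulN1r.
  apply: fun_algD; first exact: fun_alg_cst.
  by apply: fun_algM => //; exact: fun_alg_cst.
have Bd k g c0' c1' c2' : g = affine c0' c1' c2' -> fun_alg B g ->
    (forall k, fun_alg B (flat a k \o (parab (R:=R) \o g))) ->
    (forall x, differentiable (flat a k \o (parab (R:=R) \o g)) x) /\
    forall b, fun_alg B (partial b (flat a k \o (parab (R:=R) \o g))).
  move=> gE Bg Bfg.
  have dg x : differentiable g x by rewrite gE; exact: differentiable_affine.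
  have dpg x : differentiable (parab (R:=R) \o g) x.
    exact: (differentiable_comp_fun (dg x) (is_derive_parab (g x))).
  split => [x|b].
    exact: (differentiable_comp_fun (dpg x) (is_derive_flat a0 k _)).
  rewrite (_ : partial b _ = fun x =>
      ((- k%:R) * (flat a k.+1 \o (parab (R:=R) \o g)) x +
       a * (flat a k.+2 \o (parab (R:=R) \o g)) x) *
      ((1 + (-2) * g x) * (if b then c2' else c1'))).
    apply: fun_algM.
      apply: fun_algD; apply: fun_algM => //; exact: fun_alg_cst.
    apply: fun_algM; last exact: fun_alg_cst.
    apply: fun_algD; first exact: fun_alg_cst.
    by apply: fun_algM => //; exact: fun_alg_cst.
  apply/funext => x; rewrite (partial_comp _ (dpg x) (is_derive_flat a0 k _)).
  rewrite (partial_comp _ (dg x) (is_derive_parab (g x))).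
  by rewrite gE partial_affine [- 2 * _]mulNr.
apply: (@fun_alg_smooth _ B); last first.
  apply: fun_algM; apply: fun_algM; [exact: Bp|exact: (Bfs 0)|exact: Bp|exact: (Bft 0)].
move=> g [->|->|[k ->]|[k ->]].
- split; first exact: differentiable_affine.
  move=> b; rewrite (_ : partial b s = fun=> if b then c2 else c1).
    exact: fun_alg_cst.
  by apply/funext => x; exact: partial_affine.
- split; first exact: differentiable_affine.
  move=> b; rewrite (_ : partial b t = fun=> if b then e2 else e1).
    exact: fun_alg_cst.
  by apply/funext => x; exact: partial_affine.
- exact: Bd Bs Bfs.
- exact: Bd Bt Bft.
Qed.

Lemma partial_bump b c0 c1 c2 e0 e1 e2 z :
  partial b (bump (affine c0 c1 c2) (affine e0 e1 e2)) z =
  (profile a (affine c0 c1 c2 z)) *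
    (dprofile a (affine e0 e1 e2 z) * if b then e2 else e1) +
  (profile a (affine e0 e1 e2 z)) *
    (dprofile a (affine c0 c1 c2 z) * if b then c2 else c1).
Proof.
have ds := differentiable_affine c0 c1 c2 z; have dt := differentiable_affine e0 e1 e2 z.
have d1 := differentiable_comp_fun ds (is_derive_profile a0 _).
have d2 := differentiable_comp_fun dt (is_derive_profile a0 _).
rewrite /bump (partialM _ d1 d2).
rewrite (partial_comp _ ds (is_derive_profile a0 _)) (partial_comp _ dt (is_derive_profile a0 _)).
by rewrite !partial_affine.
Qed.

End parallelogram.

(** * Exact integrals of the bump and of its partial derivatives *)

Section bump_integrals.
Variable R : realType.
Local Notation leb := (@lebesgue_measure R).
Local Notation dm := (measurableTypeR R).
Variables (a x0 y0 l h d : R).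
Hypotheses (a0 : 0 < a) (l0 : 0 < l) (h0 : 0 < h).

(** The pair (s, t) inverts (p, q) |-> (x0 + p l + q d, y0 + q h), so the bump lives on the
    parallelogram with base l, height h and offset d. *)
Local Notation s := (affine (- (x0 - d / h * y0) / l) l^-1 (- (d / (h * l)))).
Local Notation t := (affine (- y0 / h) 0 h^-1).
Local Notation u := (bump a s t).
Local Notation I0 := (profile_mass a).
Local Notation I1 := (profile_energy a).
Local Notation f := (profile a).
Local Notation f' := (dprofile a).

Let sE x y : s (x, y) = (x - (x0 + d / h * (y - y0))) / l.
Proof. by rewrite /affine /=; field; rewrite !gt_eqF. Qed.

Let tE x y : t (x, y) = (y - y0) / h.
Proof. by rewrite /affine /=; field; rewrite !gt_eqF. Qed.

Let meas_profile (A B : R) :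
  measurable_fun setT (fun y : dm => (A * f' ((y - y0) / h) ^+ 2 + B * f ((y - y0) / h) ^+ 2 : dm)).
Proof.
apply: continuous_measurable_fun => y.
have cF : {for y, continuous (fun y : R => (y - y0) / h)}.
  exact: (cvgM (cvgB cvg_id (cvg_cst _)) (cvg_cst _)).
have c1 : {for y, continuous (fun y : R => f' ((y - y0) / h))}.
  by apply: (continuous_comp cF); exact: dprofile_continuous.
have c2 : {for y, continuous (fun y : R => f ((y - y0) / h))}.
  by apply: (continuous_comp cF); exact: profile_continuous.
exact: (cvgD (cvgM (cvg_cst _) (cvgM c1 c1)) (cvgM (cvg_cst _) (cvgM c2 c2))).
Qed.

Lemma integral_profile_sum (A B : R) : 0 <= A -> 0 <= B ->
  (\int[leb]_y (A * f' ((y - y0) / h) ^+ 2 + B * f ((y - y0) / h) ^+ 2)%:E =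
   (h * (A * I1 + B * I0))%:E)%E.
Proof.
move=> A0 B0.
have h1 := integral_profile a0 1 0 y0 h0; have h2 := integral_profile a0 0 1 y0 h0.
have m1 := meas_profile 1 0; have m2 := meas_profile 0 1.
have E1 : (fun y => ((1 * f' ((y - y0) / h) + 0 * f ((y - y0) / h)) ^+ 2)%:E) =
    (fun y => (f' ((y - y0) / h) ^+ 2)%:E).
  by apply/funext => y; rewrite mul1r mul0r addr0.
have E2 : (fun y => ((0 * f' ((y - y0) / h) + 1 * f ((y - y0) / h)) ^+ 2)%:E) =
    (fun y => (f ((y - y0) / h) ^+ 2)%:E).
  by apply/funext => y; rewrite mul1r mul0r add0r.
rewrite E1 in h1; rewrite E2 in h2.
have M1 : measurable_fun setT (fun y : dm => (f' ((y - y0) / h) ^+ 2)%:E).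
  apply/measurable_EFinP; move: m1; congr (measurable_fun _ _).
  by apply/funext => y; rewrite mul1r mul0r addr0.
have M2 : measurable_fun setT (fun y : dm => (f ((y - y0) / h) ^+ 2)%:E).
  apply/measurable_EFinP; move: m2; congr (measurable_fun _ _).
  by apply/funext => y; rewrite mul1r mul0r add0r.
under eq_integral do rewrite EFinD !EFinM.
rewrite ge0_integralD//; last 4 first.
- by move=> y _; rewrite -EFinM lee_fin mulr_ge0 ?sqr_ge0.
- exact: measurable_funeM.
- by move=> y _; rewrite -EFinM lee_fin mulr_ge0 ?sqr_ge0.
- exact: measurable_funeM.
rewrite ge0_integralZl//; last by move=> y _; rewrite lee_fin sqr_ge0.
rewrite ge0_integralZl//; last by move=> y _; rewrite lee_fin sqr_ge0.
rewrite h1 h2 -!EFinM -EFinD; congr EFin; ring.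
Qed.

(** A common scheme for the mass and the two energies: on a horizontal line t is constant and the
    shear only translates the profile in s, so the inner integral is [integral_profile] with
    coefficients depending on y. *)
Lemma integral_tensor (g : R * R -> R) (al be : R -> R) (A B A' B' : R) : continuous g ->
  (forall x y, g (x, y) = (al y * f' ((x - (x0 + d / h * (y - y0))) / l) +
     be y * f ((x - (x0 + d / h * (y - y0))) / l)) ^+ 2) ->
  0 <= A -> 0 <= B ->
  (forall y, l * (al y ^+ 2 * I1 + be y ^+ 2 * I0) =
     A * f' ((y - y0) / h) ^+ 2 + B * f ((y - y0) / h) ^+ 2) ->
  (\int[leb2 R]_z (g z)%:E = (h * (A * I1 + B * I0))%:E)%E.
Proof.
move=> cg gE A0 B0 AB.
have mg : measurable_fun (setT : set (dm * dm)) (EFin \o g).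
  by apply/measurable_EFinP; exact: continuous_measurable_plane.
rewrite (fubini_tonelli2 _ mg); last by move=> [x y]; rewrite /= gE lee_fin sqr_ge0.
rewrite -(integral_profile_sum A0 B0); apply: eq_integral => y _.
rewrite /fubini_G -AB -(integral_profile a0 _ _ (x0 + d / h * (y - y0)) l0).
by apply: eq_integral => x _; rewrite /= gE.
Qed.

Let su : smooth u. Proof. exact: smooth_bump. Qed.

Let cX (g : R * R -> R) : continuous g -> continuous (fun z => g z ^+ 2).
Proof. by move=> cg z; have c := cg z; exact: (cvgM c c). Qed.

Let I1_ge0 : 0 <= I1. Proof. exact: profile_energy_ge0. Qed.
Let I0_ge0 : 0 <= I0.
Proof. by apply: Rintegral_ge0 => r _; exact: sqr_ge0. Qed.

Lemma integral_bump : (\int[leb2 R]_z (u z ^+ 2)%:E = (h * l * I0 ^+ 2)%:E)%E.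
Proof.
rewrite (@integral_tensor (fun z => u z ^+ 2) (fun=> 0) (fun y => f ((y - y0) / h)) 0 (l * I0)) //.
- by congr EFin; ring.
- by apply: cX; exact: smooth_continuous.
- by move=> x y; rewrite /bump sE tE; ring.
- by rewrite mulr_ge0// ltW.
- by move=> y; ring.
Qed.

Lemma integral_bump_x : (\int[leb2 R]_z (partial false u z ^+ 2)%:E = (h / l * (I0 * I1))%:E)%E.
Proof.
rewrite (@integral_tensor (fun z => partial false u z ^+ 2) (fun y => f ((y - y0) / h) / l)
  (fun=> 0) 0 (I1 / l)) //.
- by congr EFin; field; rewrite gt_eqF.
- by apply: cX; apply: smooth_continuous; exact: smooth_partial.
- by move=> x y; rewrite partial_bump// sE tE; field; rewrite !gt_eqF.
- by rewrite divr_ge0// ltW.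
- by move=> y; field; rewrite gt_eqF.
Qed.

Lemma integral_bump_y : (\int[leb2 R]_z (partial true u z ^+ 2)%:E =
  ((d ^+ 2 / (h * l) + l / h) * (I0 * I1))%:E)%E.
Proof.
rewrite (@integral_tensor (fun z => partial true u z ^+ 2)
  (fun y => - (d / (h * l)) * f ((y - y0) / h))
  (fun y => h^-1 * f' ((y - y0) / h)) (l / h ^+ 2 * I0) (d ^+ 2 / (h ^+ 2 * l) * I1)) //.
- by congr EFin; field; rewrite !gt_eqF.
- by apply: cX; apply: smooth_continuous; exact: smooth_partial.
- by move=> x y; rewrite partial_bump// sE tE; field; rewrite !gt_eqF.
- by rewrite mulr_ge0// divr_ge0 ?sqr_ge0// ltW.
- by rewrite mulr_ge0// divr_ge0 ?sqr_ge0// mulr_ge0 ?sqr_ge0// ltW.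
- by move=> y; field; rewrite !gt_eqF.
Qed.

Lemma test_fun_bump (Om : set (R * R)) :
  (forall p q, 0 <= p <= 1 -> 0 <= q <= 1 -> Om (x0 + p * l + q * d, y0 + q * h)) ->
  test_fun Om u.
Proof.
move=> para; split => //.
pose F (z : R * R) : R * R := (affine x0 l d z, affine y0 0 h z).
have cF : continuous F.
  move=> z; apply: differentiable_continuous.
  by apply: differentiable_pair; exact: differentiable_affine.
exists (F @` (`[0, 1]%classic `*` `[0, 1]%classic)); split.
- apply: continuous_compact; first exact: continuous_subspaceT.
  by apply: compact_setX; exact: segment_compact.
- move=> _ [[p q] [/= p01 q01] <-].
  rewrite /F /affine /= mul0r addr0 [l * p]mulrC [d * q]mulrC [h * q]mulrC.
  by apply: para; [move: p01|move: q01]; rewrite in_itv.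
- move=> [x y] K; rewrite /bump sE tE.
  have [s01|/profile_out ->] := boolP (0 < (x - (x0 + d / h * (y - y0))) / l < 1); last first.
    by rewrite mul0r.
  have [t01|/profile_out ->] := boolP (0 < (y - y0) / h < 1); last by rewrite mulr0.
  exfalso; apply: K.
  exists ((x - (x0 + d / h * (y - y0))) / l, (y - y0) / h).
    move: s01 t01 => /andP[s1 s2] /andP[t1 t2].
    by split; rewrite /= in_itv/=; apply/andP; split; exact: ltW.
  by rewrite /F /affine /=; apply/pair_equal_spec; split; field; rewrite ?gt_eqF.
Qed.

End bump_integrals.

Section parallelogram_bound.
Variable R : realType.

Lemma parallelogram_bump (Om : set (R * R)) (x0 y0 l h d : R) :
  open Om -> (leb2 R Om < +oo)%E -> 0 < l -> 0 < h ->
  (forall p q, 0 <= p <= 1 -> 0 <= q <= 1 -> Om (x0 + p * l + q * d, y0 + q * h)) ->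
  exists u, [/\ test_fun Om u, 0 < \int[leb2 R]_(z in Om) (u z ^+ 2) &
    \int[leb2 R]_(z in Om) (partial false u z ^+ 2 + partial true u z ^+ 2) <=
    101 / 10 * (l ^- 2 + d ^+ 2 / (h * l) ^+ 2 + h ^- 2) *
    \int[leb2 R]_(z in Om) (u z ^+ 2)].
Proof.
move=> oOm finOm l0 h0 para.
(* Chosen so that 101/10 (1/30 - a/3) is exactly 1/3, the upper bound of the energy. *)
pose a : R := 1 / 1010.
have a0 : 0 < a by rewrite /a; lra.
have [u [tu eu ex ey]] : exists u, [/\ test_fun Om u,
    (\int[leb2 R]_z (u z ^+ 2)%:E = (h * l * profile_mass a ^+ 2)%:E)%E,
    (\int[leb2 R]_z (partial false u z ^+ 2)%:E =
      (h / l * (profile_mass a * profile_energy a))%:E)%E &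
    (\int[leb2 R]_z (partial true u z ^+ 2)%:E =
      ((d ^+ 2 / (h * l) + l / h) * (profile_mass a * profile_energy a))%:E)%E].
  eexists; split; first exact: (test_fun_bump a0 l0 h0 para).
  - exact: integral_bump.
  - exact: integral_bump_x.
  - exact: integral_bump_y.
have mOm := open_measurable_plane oOm.
have out (g : R * R -> R) : test_fun Om g ->
    \int[leb2 R]_(z in Om) (g z ^+ 2) = fine (\int[leb2 R]_z (g z ^+ 2)%:E)%E.
  move=> tg; rewrite /Rintegral integral_mkcond; congr fine; apply: eq_integral => z _.
  rewrite patchE; case: ifPn => // /negP zO.
  by rewrite (test_fun_out tg) ?expr0n// => Oz; apply: zO; exact: mem_set.
have tux := test_fun_partial false tu; have tuy := test_fun_partial true tu.
have I0 : 1 / 30 - a / 3 <= profile_mass a := profile_mass_ge a0.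
have I1 : profile_energy a <= 1 / 3 := profile_energy_le a0.
have I10 : 0 <= profile_energy a := profile_energy_ge0 a.
have I0p : 0 < profile_mass a by apply: lt_le_trans I0; rewrite /a; lra.
have I10r : profile_energy a <= 101 / 10 * profile_mass a by move: I0; rewrite /a; lra.
exists u; split; first exact: tu.
  by rewrite (out _ tu) eu/= mulr_gt0 ?exprn_gt0// mulr_gt0.
have [_ ix] := test_fun_L2 oOm finOm tux; have [_ iy] := test_fun_L2 oOm finOm tuy.
rewrite (RintegralD mOm ix iy) (out _ tux) (out _ tuy) (out _ tu).
rewrite eu ex ey/=.
set m := profile_mass a in I0 I0p I10r *; set e := profile_energy a in I1 I10 I10r *.
have -> : h / l * (m * e) + (d ^+ 2 / (h * l) + l / h) * (m * e) =
  (l ^- 2 + d ^+ 2 / (h * l) ^+ 2 + h ^- 2) * (h * l * m) * e.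
  by field; rewrite !gt_eqF.
have -> : 101 / 10 * (l ^- 2 + d ^+ 2 / (h * l) ^+ 2 + h ^- 2) * (h * l * m ^+ 2) =
  (l ^- 2 + d ^+ 2 / (h * l) ^+ 2 + h ^- 2) * (h * l * m) * (101 / 10 * m) by ring.
rewrite ler_wpM2l// !mulr_ge0// ?(ltW l0) ?(ltW h0) ?(ltW I0p)//.
by rewrite !addr_ge0// ?invr_ge0 ?divr_ge0 ?sqr_ge0.
Qed.

End parallelogram_bound.

(** * Convex planar domains *)

Section swap.
Variable R : realType.
Local Notation leb := (@lebesgue_measure R).
Local Notation dm := (measurableTypeR R).
Implicit Types (Om : set (R * R)) (f phi : R * R -> R).

Definition swap2 (z : R * R) : R * R := (z.2, z.1).

Lemma swap2K : involutive swap2.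
Proof. by case. Qed.

Lemma swap2_continuous : continuous swap2.
Proof.
move=> z; apply: differentiable_continuous; apply: differentiable_pair.
  exact: differentiable_snd.
exact: differentiable_fst.
Qed.

Lemma open_swap2 Om : open Om -> open (swap2 @^-1` Om).
Proof. by apply: open_comp => z _; exact: swap2_continuous. Qed.

Lemma convex_swap2 Om : convex2 Om -> convex2 (swap2 @^-1` Om).
Proof. by move=> cO x y Ox Oy t t01; exact: (cO (swap2 x) (swap2 y)). Qed.

(** Exchanging the coordinates amounts to exchanging the two orders of integration in Tonelli's
    theorem. *)
Lemma integral_swap2 (F : R * R -> \bar R) :
  measurable_fun (setT : set (dm * dm)) F ->
  measurable_fun (setT : set (dm * dm)) (F \o swap2) -> (forall z, 0 <= F z)%E ->
  (\int[leb2 R]_z F (swap2 z) = \int[leb2 R]_z F z)%E.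
Proof.
move=> mF mFs F0.
change (\int[leb2 R]_z (F \o swap2) z = \int[leb2 R]_z F z)%E.
rewrite (fubini_tonelli1 _ mFs (fun z => F0 (swap2 z))).
exact: (esym (@fubini_tonelli2 _ _ dm dm R lebesgue_measure lebesgue_measure F mF F0)).
Qed.

Lemma measurable_swap2 : measurable_fun (setT : set (dm * dm)) (swap2 : dm * dm -> dm * dm).
Proof. by apply/measurable_fun_pairP; split; [exact: measurable_snd|exact: measurable_fst]. Qed.

Lemma Rintegral_swap2 Om (g : R * R -> R) : open Om ->
  measurable_fun (setT : set (dm * dm)) g -> (forall z, 0 <= g z) ->
  \int[leb2 R]_(z in swap2 @^-1` Om) g (swap2 z) = \int[leb2 R]_(z in Om) g z.
Proof.
move=> oOm mg g0; rewrite /Rintegral; congr fine.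
have mOm := open_measurable_plane oOm.
have mF : measurable_fun (setT : set (dm * dm)) ((EFin \o g) \_ Om).
  apply/(measurable_restrictT _ _).1 => //.
  by apply/measurable_EFinP; exact: measurable_funTS.
rewrite [RHS]integral_mkcond -integral_swap2//.
- by rewrite [LHS]integral_mkcond.
- exact: (measurableT_comp mF measurable_swap2).
- by move=> z; rewrite patchE; case: ifP => // _; rewrite lee_fin.
Qed.

Lemma leb2_swap2 Om : open Om -> leb2 R (swap2 @^-1` Om) = leb2 R Om.
Proof.
move=> oOm; have mOm := open_measurable_plane oOm.
have mOs := open_measurable_plane (open_swap2 oOm).
have E (A : set (R * R)) : measurable (A : set (dm * dm)) ->
    leb2 R A = (\int[leb2 R]_z (\1_A z)%:E)%E.
  by move=> mA; rewrite integral_indic// setIT.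
rewrite (E _ mOm) (E _ mOs) -(integral_swap2 (F := fun z => (\1_Om z)%:E))//.
- by apply/measurable_EFinP.
- by apply/measurable_EFinP; exact: (measurableT_comp _ measurable_swap2).
Qed.

Lemma partial_swap2 b phi : partial b (phi \o swap2) = partial (~~ b) phi \o swap2.
Proof.
apply/funext => z.
have E : (fun h : R => h^-1 *: (phi (swap2 (h *: dir R b + z)) - phi (swap2 z))) =
    (fun h : R => h^-1 *: (phi (h *: dir R (~~ b) + swap2 z) - phi (swap2 z))).
  by apply/funext => h; case: z => x y; case: b.
by rewrite /partial /derive /= E.
Qed.

Lemma test_fun_swap2 Om phi : test_fun Om phi -> test_fun (swap2 @^-1` Om) (phi \o swap2).
Proof.
move=> [sp [K [cK KO K0]]]; split.
  move=> l z; have E : iter_partial l (phi \o swap2) = iter_partial (map negb l) phi \o swap2.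
    by elim: l => //= b l ->; rewrite partial_swap2.
  rewrite E; apply: differentiable_comp; last exact: sp.
  by apply: differentiable_pair; [exact: differentiable_snd|exact: differentiable_fst].
exists (swap2 @` K); split.
- by apply: continuous_compact => //; apply: continuous_subspaceT; exact: swap2_continuous.
- by move=> _ [z Kz <-]; rewrite /= swap2K; exact: KO.
- by move=> z nK; apply: K0 => Kz; apply: nK; exists (swap2 z); rewrite ?swap2K.
Qed.

End swap.

(** * Finite area bounds the widths of a convex domain *)

Section convex_geometry.
Variable R : realType.
Local Notation leb := (@lebesgue_measure R).
Local Notation dm := (measurableTypeR R).
Implicit Types (Om : set (R * R)).

Lemma open_square Om z : open Om -> Om z ->
  exists2 r : R, 0 < r & forall x y, `|x - z.1| <= r -> `|y - z.2| <= r -> Om (x, y).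
Proof.
move=> oOm Oz; have /nbhs_ballP[e /= e0 eO] : nbhs z Om by exact: open_nbhs_nbhs.
exists (e / 2) => [|x y hx hy]; first by rewrite divr_gt0.
by apply: eO; split; rewrite /ball/= distrC; apply: (le_lt_trans (y := e / 2)) => //; lra.
Qed.

(** The domain contains the hull of z and a square about c. Over the half of the segment nearer to
    c, the vertical sections of this hull have length at least r, so the area is at least r |z.1 -
    c.1| / 2. *)
Lemma convex_width_le Om (c : R * R) (r : R) (z : R * R) : open Om -> convex2 Om -> (leb2 R Om < +oo)%E ->
  0 < r -> (forall x y, `|x - c.1| <= r -> `|y - c.2| <= r -> Om (x, y)) -> Om z ->
  `|z.1 - c.1| <= 2 * fine (leb2 R Om) / r.
Proof.
move=> oOm cOm fin r0 sq Oz.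
have [->|D0] := eqVneq (z.1 - c.1) 0.
  by rewrite normr0 divr_ge0 ?(ltW r0)// mulr_ge0// fine_ge0.
have mOm := open_measurable_plane oOm.
have [lo [hi [lohi hl lohiP]]] : exists lo hi : R, [/\ lo < hi,
    hi - lo = `|z.1 - c.1| / 2 &
    forall x, lo <= x <= hi -> 0 <= (x - c.1) / (z.1 - c.1) <= 1 / 2].
  have [cz|zc|E] := ltgtP c.1 z.1; last by move: D0; rewrite E subrr eqxx.
    have D1 : 0 < z.1 - c.1 by rewrite subr_gt0.
    exists c.1, ((c.1 + z.1) / 2); split; [lra|rewrite gtr0_norm//; lra|].
    move=> x /andP[x1 x2]; rewrite divr_ge0 ?subr_ge0 ?(ltW cz)//=.
    by rewrite ler_pdivrMr//; lra.
  have D1 : z.1 - c.1 < 0 by rewrite subr_lt0.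
  exists ((c.1 + z.1) / 2), c.1; split; [lra|rewrite ltr0_norm//; lra|].
  move=> x /andP[x1 x2]; rewrite -mulrNN -invrN !opprB divr_ge0 ?subr_ge0 ?(ltW zc)//=.
  by rewrite ler_pdivrMr ?subr_gt0//; lra.
pose J : set R := `[lo, hi]%classic.
have mJ : measurable (J : set dm) by exact: measurable_itv.
have lbJ : leb J = (`|z.1 - c.1| / 2)%:E.
  by rewrite /J lebesgue_measure_itv/= lte_fin lohi -EFinB hl.
have sec x : J x -> (r%:E <= leb (xsection Om x))%E.
  rewrite /J/= in_itv/= => /lohiP.
  set tau := (x - c.1) / (z.1 - c.1) => /andP[tau0 tau1].
  pose m := (1 - tau) * c.2 + tau * z.2.
  have sub : `[m - r / 2, m + r / 2]%classic `<=` xsection Om x.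
    move=> y; rewrite /= in_itv/= => /andP[y1 y2]; apply/mem_set.
    (* Pulling y back to the vertical midline of the square: |y - m| <= r / 2 and 1 - tau >= 1 / 2
       give |s| <= r. *)
    pose s := (y - m) / (1 - tau).
    have hs : `|s| <= r.
      rewrite normrM normfV (ger0_norm (_ : 0 <= 1 - tau)); last by lra.
      rewrite ler_pdivrMr; last by lra.
      rewrite ler_norml; apply/andP; split; nra.
    have := cOm (c.1, c.2 + s) z (sq _ _ _ _) Oz tau.
    rewrite subrr normr0 addrAC subrr add0r => /(_ (ltW r0) hs).
    rewrite tau0 (le_trans tau1) /=; last by lra.
    move=> /(_ isT); congr (Om _); apply/pair_equal_spec; split.
      by rewrite /tau; field.
    by rewrite /s /m; field; rewrite gt_eqF//; lra.
  apply: (@le_trans _ _ (leb `[m - r / 2, m + r / 2]%classic)).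
    rewrite lebesgue_measure_itv/= lte_fin ifT; last by lra.
    by rewrite -EFinB lee_fin; lra.
  by apply: le_measure => //; rewrite inE; [exact: measurable_itv|exact: measurable_xsection].
have : (\int[leb]_(x in J) r%:E <= leb2 R Om)%E.
  apply: (@le_trans _ _ (\int[leb]_(x in J) leb (xsection Om x))%E).
    apply: ge0_le_integral => //.
    - by move=> x _; rewrite lee_fin ltW.
    - by apply: measurable_funTS; exact: measurable_fun_xsection.
  rewrite [leRHS](_ : _ = \int[leb]_x leb (xsection Om x))%E//.
  apply: ge0_subset_integral => //.
  exact: measurable_fun_xsection.
have -> : (\int[leb]_(x in J) r%:E = r%:E * (`|z.1 - c.1| / 2)%:E)%E.
  by rewrite -lbJ; exact: integral_cst.
have finn : leb2 R Om \is a fin_num by rewrite ge0_fin_numE.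
rewrite -EFinM -(fineK finn) lee_fin => h.
by rewrite ler_pdivlMr//; lra.
Qed.


Lemma convex_bounded Om : open Om -> convex2 Om -> (leb2 R Om < +oo)%E ->
  exists C : R, forall z w, Om z -> Om w -> z.1 - w.1 <= C /\ z.2 - w.2 <= C.
Proof.
move=> oOm cOm fin.
have [[c Oc]|O0] := pselect (exists c, Om c); last first.
  by exists 0 => z w Oz; exfalso; apply: O0; exists z.
have [r r0 sq] := open_square oOm Oc.
pose W : R := 2 * fine (leb2 R Om) / r.
suff H (A : set (R * R)) (e : R * R) : open A -> convex2 A -> leb2 R A = leb2 R Om ->
    (forall x y, `|x - e.1| <= r -> `|y - e.2| <= r -> A (x, y)) ->
    forall z, A z -> `|z.1 - e.1| <= W.
  have h1 z Oz := H Om c oOm cOm erefl sq z Oz.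
  have h2 z (Oz : Om z) : `|z.2 - c.2| <= W.
    apply: (H (swap2 (R:=R) @^-1` Om) (swap2 c) _ _ _ _ (swap2 z)).
    - exact: open_swap2.
    - exact: convex_swap2.
    - exact: leb2_swap2.
    - by move=> x y hx hy; exact: sq.
    - by rewrite /= swap2K.
  exists (2 * W) => z w Oz Ow.
  have := h1 _ Oz; have := h1 _ Ow; have := h2 _ Oz; have := h2 _ Ow.
  by rewrite !ler_norml => /andP[? ?] /andP[? ?] /andP[? ?] /andP[? ?]; split; lra.
move=> oA cA AE sqA z Az; rewrite /W -AE.
by apply: convex_width_le => //; rewrite AE.
Qed.

End convex_geometry.

Section convex_domains.
Variable R : realType.
Implicit Types (Om : set (R * R)).

(** Every horizontal chord is at most the horizontal width, hence at most the vertical one. A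
    segment B T of nearly maximal vertical extent is therefore at least about L high, and its
    horizontal offset is at most about its height. *)
Lemma convex_horizontal Om : open Om -> convex2 Om -> Om !=set0 -> (leb2 R Om < +oo)%E ->
  sup [set w | exists z z', [/\ Om z, Om z' & w = z.1 - z'.1]] <=
  sup [set w | exists z z', [/\ Om z, Om z' & w = z.2 - z'.2]] ->
  exists L : R, [/\ 0 < L,
    forall x x' y, Om (x, y) -> Om (x', y) -> x - x' <= L &
    exists u, [/\ test_fun Om u, 0 < \int[leb2 R]_(z in Om) (u z ^+ 2) &
      \int[leb2 R]_(z in Om) (partial false u z ^+ 2 + partial true u z ^+ 2) <=
      130 / L ^+ 2 * \int[leb2 R]_(z in Om) (u z ^+ 2)]].
Proof.
move=> oOm cOm [c Oc] fin; set X := [set w | _]; set Y := [set w | _] => XY.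
have [C HC] := convex_bounded oOm cOm fin.
pose S := [set w | exists x x' y, [/\ Om (x, y), Om (x', y) & w = x - x']].
have hX : has_sup X.
  split; first by exists (c.1 - c.1), c, c.
  by exists C => w [z [z' [Oz Oz' ->]]]; case: (HC z z' Oz Oz').
have hY : has_sup Y.
  split; first by exists (c.2 - c.2), c, c.
  by exists C => w [z [z' [Oz Oz' ->]]]; case: (HC z z' Oz Oz').
have SX : S `<=` X.
  by move=> w [x [x' [y [Hx Hx' ->]]]]; exists (x, y), (x', y).
have [r r0 sq] := open_square oOm Oc.
have Sr : S r.
  exists (c.1 + r), c.1, c.2; split; last by ring.
    by apply: sq; rewrite ?subrr ?normr0 ?(ltW r0)// addrAC subrr add0r gtr0_norm.
  by apply: sq; rewrite subrr normr0 ltW.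
have hS : has_sup S.
  by split; [exists r|exists C => w /SX[z [z' [Oz Oz' ->]]]; case: (HC z z' Oz Oz')].
pose L := sup S.
have L0 : 0 < L by apply: lt_le_trans r0 _; exact: sup_upper_bound.
have LX : L <= sup X by apply: sup_le_ub; [exists r|move=> w /SX; exact: sup_upper_bound].
exists L; split => //.
  by move=> x x' y Hx Hx'; apply: sup_upper_bound => //; exists x, x', y.
have LY : L <= sup Y := le_trans LX XY.
(* On an open domain the suprema need not be attained; the loss of one percent, here and for the
   vertical width, is paid for in the constant 130. *)
have [_ [x1 [x2 [y [Hx Hx' ->]]]] hl] : exists2 w, S w & 99 / 100 * L < w.
  by apply: sup_gt => //; [exists r|rewrite -/L; lra].
have [_ [T [B [OT OB ->]]] hh] : exists2 w, Y w & 99 / 100 * sup Y < w.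
  apply: sup_gt => //; [by case: hY|].
  by have : 0 < sup Y := lt_le_trans L0 LY; lra.
have hd : `|T.1 - B.1| <= sup X.
  rewrite ler_norml; apply/andP; split; last by apply: sup_upper_bound => //; exists T, B.
  by rewrite lerNl opprB; apply: sup_upper_bound => //; exists B, T.
pose l := (x1 - x2) / 2; pose h := (T.2 - B.2) / 2; pose d := (T.1 - B.1) / 2.
have l0 : 0 < l by rewrite /l; lra.
have h0 : 0 < h by rewrite /h; lra.
(* The corner is the midpoint of B and the left end of the chord. A general point is the midpoint of
   a point of the chord (parameter p) and one of the segment B T (parameter q). *)
have [|u [tu u0 uE]] := @parallelogram_bump R Om ((B.1 + x2) / 2) ((B.2 + y) / 2) l h d oOm fin l0 h0.
  move=> p q p01 q01.
  have h1 := cOm (x2, y) (x1, y) Hx' Hx p p01.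
  have h2 := cOm B T OB OT q q01.
  have h12 : (0 <= (2^-1 : R)) && (2^-1 <= (1 : R)) by apply/andP; split; lra.
  have := cOm _ _ h1 h2 _ h12; congr (Om _).
  by apply/pair_equal_spec; split => /=; rewrite /l /d /h; field.
exists u; split => //; apply: le_trans uE _; rewrite ler_wpM2r ?(ltW u0)//.
have L2 : 0 < L ^+ 2 by rewrite exprn_gt0.
set i := (L ^+ 2)^-1; have i0 : 0 < i by rewrite invr_gt0.
have il : l ^- 2 <= 21 / 5 * i.
  rewrite /i ler_pdivlMr// mulrC ler_pdivrMr ?exprn_gt0//.
  have : 99 / 200 * L <= l by rewrite /l; lra.
  nra.
have ih : h ^- 2 <= 21 / 5 * i.
  rewrite /i ler_pdivlMr// mulrC ler_pdivrMr ?exprn_gt0//.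
  have : 99 / 200 * L <= h by rewrite /h; lra.
  nra.
have idh : d ^+ 2 / h ^+ 2 <= 21 / 20.
  rewrite ler_pdivrMr ?exprn_gt0// -(real_normK (num_real d)).
  have : `|d| <= 100 / 99 * h.
    move: hd; rewrite !ler_norml => /andP[hd1 hd2].
    by apply/andP; split; rewrite /d /h; lra.
  have := normr_ge0 d; nra.
have -> : d ^+ 2 / (h * l) ^+ 2 = d ^+ 2 / h ^+ 2 * l ^- 2.
  by field; rewrite !gt_eqF.
have dl : d ^+ 2 / h ^+ 2 * l ^- 2 <= 21 / 20 * (21 / 5 * i).
  by apply: ler_pM => //; rewrite ?invr_ge0 ?divr_ge0 ?sqr_ge0.
(* The constants combine to 101/10 times 21/5 times (1 + 21/20 + 1) = 129.381, below 130. *)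
move: il ih dl; rewrite -/i; lra.
Qed.

(** The boolean b records along which axis the chords are taken; mass and full energy are symmetric
    in the coordinates, so only the chord inequality depends on it. *)
Lemma convex_key Om : open Om -> convex2 Om -> Om !=set0 -> (leb2 R Om < +oo)%E ->
  exists b (L : R), [/\ 0 < L,
    forall k M phi, 0 <= k -> M = k + k ^+ 2 * L ^+ 2 / 4 -> test_fun Om phi ->
      k * fine (leb2 R Om) <=
      \int[leb2 R]_(z in Om) (partial b phi z ^+ 2 + M * (phi z - 1) ^+ 2) &
    exists u, [/\ test_fun Om u, 0 < \int[leb2 R]_(z in Om) (u z ^+ 2) &
      \int[leb2 R]_(z in Om) (partial false u z ^+ 2 + partial true u z ^+ 2) <=
      130 / L ^+ 2 * \int[leb2 R]_(z in Om) (u z ^+ 2)]].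
Proof.
move=> oOm cOm O0 fin; have eqle (x y : R) : x = y -> x <= y by move=> ->.
have [XY|YX] := leP (sup [set w | exists z z', [/\ Om z, Om z' & w = z.1 - z'.1]])
  (sup [set w | exists z z', [/\ Om z, Om z' & w = z.2 - z'.2]]).
  have [L [L0 sl uP]] := convex_horizontal oOm cOm O0 fin XY.
  exists false, L; split => // k M phi k0 ME tp.
  exact: (horizontal_slice_inequality oOm fin k0 (ltW L0) sl ME tp).
pose Om' := swap2 (R:=R) @^-1` Om.
have oOm' : open Om' := open_swap2 oOm.
have cOm' : convex2 Om' := convex_swap2 cOm.
have O0' : Om' !=set0 by case: O0 => z Oz; exists (swap2 z); rewrite /Om' /= swap2K.
have mE : leb2 R Om' = leb2 R Om := leb2_swap2 oOm.
have fin' : (leb2 R Om' < +oo)%E by rewrite mE.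
have swapE (g : R * R -> R) : continuous g -> (forall z, 0 <= g z) ->
    \int[leb2 R]_(z in Om') g (swap2 z) = \int[leb2 R]_(z in Om) g z.
  by move=> cg g0; apply: Rintegral_swap2 => //; exact: continuous_measurable_plane.
have cX (g : R * R -> R) : continuous g -> continuous (fun z => g z ^+ 2).
  by move=> cg z; have cz := cg z; exact: (cvgM cz cz).
have ctest (A : set (R * R)) (phi : R * R -> R) : test_fun A phi -> continuous phi.
  by move=> [sp _]; exact: smooth_continuous.
have [|L [L0 sl [u [tu u0 uE]]]] := convex_horizontal oOm' cOm' O0' fin'.
  apply: le_trans (_ : _ <= sup [set w | exists z z', [/\ Om z, Om z' & w = z.2 - z'.2]]) _.
    apply: eqle; congr sup; apply/seteqP; split => w [z [z' [Oz Oz' ->]]].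
      by exists (swap2 z), (swap2 z').
    by exists (swap2 z), (swap2 z'); rewrite /Om' /= !swap2K.
  apply: le_trans (ltW YX) _.
  apply: eqle; congr sup; apply/seteqP; split => w [z [z' [Oz Oz' ->]]].
    by exists (swap2 z), (swap2 z'); rewrite /Om' /= !swap2K.
  by exists (swap2 z), (swap2 z').
exists true, L; split => //.
  move=> k M phi k0 ME tp.
  have tps := test_fun_swap2 tp.
  have := horizontal_slice_inequality oOm' fin' k0 (ltW L0) sl ME tps.
  rewrite mE partial_swap2 => /le_trans; apply.
  have M0 : 0 <= M by rewrite ME addr_ge0// divr_ge0// mulr_ge0 ?sqr_ge0.
  rewrite (swapE (fun z => partial true phi z ^+ 2 + M * (phi z - 1) ^+ 2))//.
    move=> z; have c1 := ctest _ _ tp z; have c2 := ctest _ _ (test_fun_partial true tp) z.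
    apply: (cvgD (cvgM c2 c2)); apply: (cvgM (cvg_cst _)).
    by apply: cvgM; exact: (cvgB c1 (cvg_cst _)).
  by move=> z; rewrite addr_ge0 ?sqr_ge0// mulr_ge0 ?sqr_ge0.
have tus : test_fun Om (u \o swap2 (R:=R)).
  have := test_fun_swap2 tu; congr (test_fun _ _).
  by apply/seteqP; split => z; rewrite /Om' /= swap2K.
have uu : \int[leb2 R]_(z in Om) ((u \o swap2 (R:=R)) z ^+ 2) = \int[leb2 R]_(z in Om') (u z ^+ 2).
  rewrite -(swapE (fun z => (u \o swap2 (R:=R)) z ^+ 2)); last 2 first.
  - by apply: cX; exact: ctest tus.
  - by move=> z; exact: sqr_ge0.
  by apply: eq_Rintegral => z _; rewrite /= swap2K.
exists (u \o swap2 (R:=R)); split => //; first by rewrite uu.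
rewrite uu; apply: le_trans uE; apply: eqle.
rewrite -(swapE (fun z => partial false (u \o swap2 (R:=R)) z ^+ 2 +
  partial true (u \o swap2 (R:=R)) z ^+ 2)); last 2 first.
- move=> z; have c1 := ctest _ _ (test_fun_partial false tus) z.
  have c2 := ctest _ _ (test_fun_partial true tus) z.
  exact: (cvgD (cvgM c1 c1) (cvgM c2 c2)).
- by move=> z; rewrite addr_ge0 ?sqr_ge0.
by apply: eq_Rintegral => z _; rewrite !partial_swap2 /= swap2K addrC.
Qed.

End convex_domains.

(** * From the moment bounds to [Fp] and [p2convex] *)

Section main_bound.
Variable R : realType.
Implicit Types (Om : set (R * R)).
Local Notation dm := (measurableTypeR R).

(** Young's inequality for s^th and 1 with exponents 1/th and 1/(1 - th); these degenerate at th = 0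
    and th = 1, treated apart. *)
Lemma powR_le_affine (s th : R) : 0 <= s -> 0 <= th <= 1 -> s `^ th <= 1 - th + th * s.
Proof.
move=> s0 /andP[th0 th1].
move: th0; rewrite le_eqVlt => /predU1P[<-|th0]; first by rewrite powRr0; lra.
move: th1; rewrite le_eqVlt => /predU1P[->|th1]; first by rewrite powRr1//; lra.
have th1' : 0 < 1 - th by lra.
have := @conjugate_powR R (s `^ th) 1 th^-1 (1 - th)^-1 (powR_ge0 _ _) ler01.
rewrite !invr_gt0 !invrK => /(_ th0 th1' ltac:(ring)).
by rewrite mulr1 -powRrM mulfV ?gt_eqF// powRr1// powR1; lra.
Qed.

Section domain.
Variables (Om : set (R * R)) (v g1 g2 : R * R -> R).
Hypotheses (oOm : open Om) (cOm : convex2 Om) (posOm : (0 < leb2 R Om)%E)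
  (finOm : (leb2 R Om < +oo)%E) (tv : torsion Om v g1 g2).

Local Notation mu := (leb2 R).
Local Notation I f := (\int[mu]_(x in Om) f x)%R.
Local Notation A := (fine (leb2 R Om)).
Local Notation lam := (fine (lambda1 Om)).

Let mOm : measurable (Om : set (dm * dm)).
Proof. exact: open_measurable_plane. Qed.

Let OmN0 : Om !=set0.
Proof. by apply/set0P/eqP => O0; move: posOm; rewrite O0 measure0 ltxx. Qed.

Let lam0 : 0 <= lam.
Proof. by apply: fine_ge0; exact: lambda1_ge0. Qed.

Lemma lambda1_fin_num : lambda1 Om \is a fin_num.
Proof.
have [b [L [L0 _ [u [tu u0 _]]]]] := convex_key oOm cOm OmN0 finOm.
rewrite ge0_fin_numE ?lambda1_ge0//.
by apply: le_lt_trans (lambda1_le tu u0) _; rewrite ltry.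
Qed.

Lemma torsion_square_deficit : lam ^+ 2 * I (fun x => v x ^+ 2) <= 130 / 131 * A.
Proof.
have [b [L [L0 slice [u [tu u0 uE]]]]] := convex_key oOm cOm OmN0 finOm.
have L2 : 0 < L ^+ 2 by rewrite exprn_gt0.
have lamL : lam <= 130 / L ^+ 2.
  rewrite -lee_fin fineK ?lambda1_fin_num//.
  apply: le_trans (lambda1_le tu u0) _.
  by rewrite lee_fin ler_pdivrMr.
(* Twice the bound on lam, the optimal choice; then M L^2 = 260 + 260^2 / 4 = 17160. *)
pose k : R := 260 / L ^+ 2.
pose M : R := k + k ^+ 2 * L ^+ 2 / 4.
have k0 : 0 <= k by rewrite divr_ge0// ltW.
have ME : M = 17160 / L ^+ 2 by rewrite /M /k; field; rewrite gt_eqF.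
have M0 : 0 <= M by rewrite /M addr_ge0// divr_ge0// mulr_ge0 ?sqr_ge0.
have ray := @Rayleigh R Om.
have h1 := slice_limit oOm finOm lam tv M0 (fun phi => slice k M phi k0 erefl).
have h2 := torsion_Rayleigh oOm finOm tv ray.
set a := I (fun x => v x ^+ 2) in h1 h2 *; set bb := I v in h1 h2.
have a0 : 0 <= a by apply: Rintegral_ge0 => x _; exact: sqr_ge0.
have b0 : 0 <= bb by apply: le_trans h2; rewrite mulr_ge0.
have xy : lam ^+ 2 * a <= lam * bb by rewrite expr2 -mulrA ler_wpM2l.
have y0 : 0 <= lam * bb by rewrite mulr_ge0.
have ly : lam ^+ 2 * bb <= 130 / L ^+ 2 * (lam * bb).
  by rewrite expr2 -mulrA ler_wpM2r.
have h3 : M * (lam ^+ 2 * a - 2 * lam * bb + A) <= M * (A - lam * bb).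
  by rewrite ler_wpM2l//; lra.
have h4 : k * A <= 130 / L ^+ 2 * (lam * bb) + M * (A - lam * bb) by lra.
(* Here lam bb = int w, and the inequality reads 17030 int w <= 16900 A, that is int w <= 130/131
   A. *)
have h5 : 260 * A <= 130 * (lam * bb) + 17160 * (A - lam * bb).
  move: h4; rewrite ME /k.
  have -> : 260 / L ^+ 2 * A = 260 * A / L ^+ 2 by ring.
  have -> : 130 / L ^+ 2 * (lam * bb) + 17160 / L ^+ 2 * (A - lam * bb) =
    (130 * (lam * bb) + 17160 * (A - lam * bb)) / L ^+ 2 by ring.
  by rewrite ler_pM2r// invr_gt0.
by apply: le_trans xy _; lra.
Qed.

Lemma torsion_power_bound (p : R) : 1 <= p -> p <= 2 + 2 / 107 -> 0 < lam ->
  (\int[mu]_(x in Om) ((lam * `|v x|) `^ p)%:E <= A%:E)%E.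
Proof.
move=> p1 p2 lam1.
have vL := torsion_L2 oOm finOm tv; have [mv iv2] := vL.
have defi := torsion_square_deficit.
have A0 : 0 <= A by apply: fine_ge0.
pose t x := lam * `|v x|.
have t0 x : 0 <= t x by rewrite mulr_ge0.
have t2 x : t x ^+ 2 = lam ^+ 2 * v x ^+ 2 by rewrite /t exprMn real_normK ?num_real.
have mt : measurable_fun (Om : set (dm * dm)) t.
  apply: measurable_funM; first exact: measurable_cst.
  exact: measurableT_comp.
have mtp : measurable_fun (Om : set (dm * dm)) (fun x => (t x `^ p)%:E).
  apply/measurable_EFinP; apply: (measurableT_comp (measurable_powR p)); exact: mt.
have sq_integral : (\int[mu]_(x in Om) (t x ^+ 2)%:E = (lam ^+ 2 * I (fun x => v x ^+ 2))%:E)%E.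
  under eq_integral do rewrite t2.
  by rewrite -(RintegralZl _ mOm iv2) fineK//; apply: integrable_fin_num => //;
     exact: integrable_funZ.
have mt2 : measurable_fun (Om : set (dm * dm)) (fun x => (t x ^+ 2)%:E).
  by apply/measurable_EFinP; exact: measurable_funX.
(* For p <= 2 the interpolation is between the powers 0 and 2: t^p <= 1 - p/2 + p/2 t^2, and int t^2
   <= A suffices. *)
have [p2'|p2'] := leP p 2.
  apply: (@le_trans _ _ (\int[mu]_(x in Om) ((1 - p / 2)%:E + (p / 2)%:E * (t x ^+ 2)%:E))%E).
    apply: ge0_le_integral => //.
    - by move=> x _; rewrite lee_fin powR_ge0.
    - by apply: emeasurable_funD; [exact: measurable_cst|exact: measurable_funeM].
    move=> x _; rewrite -EFinM -EFinD lee_fin -/(t x).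
    have := @powR_le_affine (t x ^+ 2) (p / 2) (sqr_ge0 _) ltac:(apply/andP; split; lra).
    by rewrite -(powR_mulrn 2 (t0 x)) -powRrM mulrCA mulfV// mulr1.
  rewrite ge0_integralD//; last 3 first.
  - by move=> x _; rewrite lee_fin; lra.
  - by move=> x _; rewrite -EFinM lee_fin mulr_ge0 ?sqr_ge0//; lra.
  - exact: measurable_funeM.
  rewrite ge0_integralZl//; last 2 first.
  - by move=> x _; rewrite lee_fin sqr_ge0.
  - by rewrite lee_fin; lra.
  rewrite integral_cst// sq_integral -(fineK (_ : mu Om \is a fin_num)); last by rewrite ge0_fin_numE.
  by rewrite -!EFinM -EFinD lee_fin; nra.
(* Then t^p = t^2 (t^2)^th, and the affine bound is applied to the second factor. *)
pose th := (p - 2) / 2.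
have th0 : 0 <= th by rewrite /th; lra.
have th1 : th <= 1 / 107 by rewrite /th; lra.
have four : (\int[mu]_(x in Om) (t x ^+ 4)%:E <=
    (16 / 9 * (lam ^+ 2 * I (fun x => v x ^+ 2)))%:E)%E.
  have E x : t x ^+ 4 = lam ^+ 4 * v x ^+ 4.
    have -> : t x ^+ 4 = (t x ^+ 2) ^+ 2 by rewrite -exprM.
    by rewrite t2; ring.
  under eq_integral do rewrite E EFinM.
  rewrite ge0_integralZl//; last 3 first.
  - by apply/measurable_EFinP; exact: measurable_funX.
  - by move=> x _; rewrite lee_fin (_ : 4 = 2 * 2)%N// exprM sqr_ge0.
  - by rewrite lee_fin exprn_ge0.
  have := torsion_fourth_moment oOm finOm tv (ltW lam1) (@Rayleigh R Om) lam1.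
  move=> /(lee_wpmul2l (_ : (0 <= (lam ^+ 4)%:E)%E)) => /(_ ltac:(by rewrite lee_fin exprn_ge0)).
  move=> /le_trans; apply; rewrite -EFinM lee_fin le_eqVlt; apply/orP; left; apply/eqP.
  by field; rewrite gt_eqF.
apply: (@le_trans _ _ (\int[mu]_(x in Om) ((1 - th)%:E * (t x ^+ 2)%:E + th%:E * (t x ^+ 4)%:E))%E).
  have mt4 : measurable_fun (Om : set (dm * dm)) (fun x => (t x ^+ 4)%:E).
    by apply/measurable_EFinP; exact: measurable_funX.
  apply: ge0_le_integral => //.
  - by move=> x _; rewrite lee_fin powR_ge0.
  - by apply: emeasurable_funD; exact: measurable_funeM.
  move=> x _; rewrite -!EFinM -EFinD lee_fin -/(t x).
  have := @powR_le_affine (t x ^+ 2) th (sqr_ge0 _) ltac:(apply/andP; split; lra).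
  rewrite -{1}(powR_mulrn 2 (t0 x)) -powRrM => /(ler_wpM2l (sqr_ge0 (t x))).
  rewrite -{1}(powR_mulrn 2 (t0 x)) -powRD; last by rewrite gt_eqF//; lra.
  rewrite (_ : 2%:R + 2 * th = p); last by rewrite /th; field.
  by move=> /le_trans; apply; rewrite le_eqVlt; apply/orP; left; apply/eqP; ring.
rewrite ge0_integralD//; last 4 first.
- by move=> x _; rewrite -EFinM lee_fin mulr_ge0 ?sqr_ge0//; lra.
- exact: measurable_funeM.
- by move=> x _; rewrite -EFinM lee_fin mulr_ge0// exprn_ge0.
- by apply: measurable_funeM; apply/measurable_EFinP; exact: measurable_funX.
rewrite ge0_integralZl//; last 2 first.
- by move=> x _; rewrite lee_fin sqr_ge0.
- by rewrite lee_fin; lra.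
rewrite ge0_integralZl//; last 2 first.
- by apply/measurable_EFinP; exact: measurable_funX.
- by move=> x _; rewrite lee_fin exprn_ge0.
rewrite sq_integral.
apply: le_trans (leeD2l _ (lee_wpmul2l _ four)) _; first by rewrite lee_fin.
(* What remains is (1 + 7/9 th) 130/131 <= 1, true up to th = 9/910, which exceeds 1/107. *)
rewrite -!EFinM -EFinD lee_fin; nra.
Qed.

(** By homogeneity the bound int |w|^p <= A says that the L^p norm of v is at most A^(1/p) / lam;
    when lam = 0 the product [Fp] is 0. *)
Lemma Fp_le1 (p : R) : 1 <= p -> p <= 2 + 2 / 107 -> (Fp Om p v <= 1)%E.
Proof.
move=> p1 p2; have p0 : 0 < p by lra.
have lamE : lambda1 Om = lam%:E by rewrite fineK// lambda1_fin_num.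
rewrite /Fp lamE.
move: lam0; rewrite le_eqVlt => /predU1P[<-|lam1]; first by rewrite mule0 mul0e lee01.
have A0 : 0 < A by apply: fine_gt0; rewrite posOm finOm.
have h := torsion_power_bound p1 p2 lam1.
have N : (Lnorm mu p%:E (fun x => (v x * \1_Om x)%:E) <= (A `^ p^-1 / lam)%:E)%E.
  rewrite unlock.
  have E : (\int[mu]_x `|(v x * \1_Om x)%:E| `^ p = \int[mu]_(x in Om) (`|v x| `^ p)%:E)%E.
    rewrite [RHS]integral_mkcond; apply: eq_integral => x _; rewrite patchE indicE.
    case: ifP => _; first by rewrite mulr1.
    by rewrite mulr0 /= normr0 powR0// gt_eqF.
  have B : (\int[mu]_(x in Om) (`|v x| `^ p)%:E <= (A / lam `^ p)%:E)%E.
    move: h; under eq_integral do rewrite powRM// EFinM.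
    have [mv _] := torsion_L2 oOm finOm tv.
    rewrite ge0_integralZl//; last 2 first.
    - apply/measurable_EFinP; apply: (measurableT_comp (measurable_powR p)).
      exact: measurableT_comp.
    - by rewrite lee_fin powR_ge0.
    by rewrite muleC -lee_pdivlMr ?powR_gt0// -EFinM.
  rewrite E; apply: (@le_trans _ _ ((A / lam `^ p)%:E `^ p^-1)%E).
    apply: gt0_ler_poweR => //; rewrite ?invr_ge0 ?(ltW p0)//; rewrite in_itv/= leey andbT.
      by apply: integral_ge0 => x _; rewrite lee_fin powR_ge0.
    by rewrite lee_fin divr_ge0 ?powR_ge0// ltW.
  rewrite poweR_EFin lee_fin powRM ?invr_ge0 ?powR_ge0 ?(ltW A0)//.
  rewrite -powRN -powRrM mulNr mulfV ?gt_eqF// powR_inv1// ltW//.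
have Ap : 0 < A `^ p^-1 by rewrite powR_gt0.
apply: (@le_trans _ _ ((A `^ p^-1 / lam)%:E * lam%:E * ((A `^ p^-1)^-1)%:E)%E).
  apply: lee_wpmul2r; first by rewrite lee_fin invr_ge0 ltW.
  by apply: lee_wpmul2r.
by rewrite -!EFinM lee_fin le_eqVlt; apply/orP; left; apply/eqP; field; rewrite !gt_eqF.
Qed.

End domain.

Lemma p2convex_ge (q : R) : q <= 2 + 2 / 107 -> (q%:E <= p2convex R)%E.
Proof.
move=> q2; apply: le_ereal_inf_tmp => _ [p [p1 Fp1 ->]]; rewrite lee_fin leNgt.
apply/negP => pq; move: Fp1; apply/negP; rewrite -leNgt.
apply: ge_ereal_sup => _ [Om [v [g1 [g2 [[oOm cOm] posOm finOm tv ->]]]]].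
by apply: (Fp_le1 oOm cOm posOm finOm tv p1); lra.
Qed.

End main_bound.

Theorem theorem3 (R : realType) :
  ((20186%:R / 10000%:R : R)%:E <= p2convex R)%E /\
  ((2 + 2 / Num.sqrt (11559%:R : R))%:E <= p2convex R)%E.
Proof.
split; apply: p2convex_ge; first by lra.
(* It remains to see that 107 is at most the square root of 11559, and 107^2 = 11449. *)
rewrite lerD2l ler_wpM2l// lef_pV2 ?posrE ?sqrtr_gt0//.
have := @sqr_sqrtr R 11559%:R (ler0n _ _); have := sqrtr_ge0 (11559%:R : R).
set s := Num.sqrt _ => s0 sE; rewrite leNgt; apply/negP => s1.
by nra.
Qed.
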